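(* Let $H$ be a real separable Hilbert space, $d\in\mathbb N$, $d\ge 1$, $\dim H\ge d+1$, and let $\mu$ be a Borel probability measure on $H$ with bounded support. Let $\sigma_1\ge\sigma_2\ge\dots$ be the singular values of the data-to-features operator $A_\mu$, and $v_1,v_2,\dots$ the corresponding orthonormal right vectors. Then a least squares $d$-flat for $\mu$ exists, and one is given by $$x_{\mathrm{cm}}+\mathrm{Sp}\{v_1,\ldots,v_d\},$$ where $v_1,\dots,v_d$ are the top right vectors of $A_\mu$. The least squares $d$-flat is unique if and only if $\sigma_d>\sigma_{d+1}$. Moreover, $$e_2(\mu,d)=\sqrt{\sum_{i>d}\sigma_i^2}.$$
   Context: $\mathrm{AG}_d(H)$ is the set of all $d$-flats ($d$-dimensional affine subspaces) of $H$, and $\operatorname{dist}(x,L)$ is the distance from $x$ to $L$. The $d$-dimensional least squares error is $e_2(\mu,d)=\inf_{L\in \mathrm{AG}_d(H)}\sqrt{\int \operatorname{dist}^2(x,L)\,d\mu(x)}$. A least squares (LS) $d$-flat for $\mu$ is an $L\in\mathrm{AG}_d(H)$ at which this infimum is attained. The center of mass of $\mu$ is $x_{\mathrm{cm}}=\int x\,d\mu(x)$. The data-to-features operator $A_\mu:H\to L_2(\mu)$ is $(A_\mu y)(x)=\langle y,x-x_{\mathrm{cm}}\rangle$; it is Hilbert-Schmidt, hence compact. Its singular values $\sigma_1\ge\sigma_2\ge\dots\ge 0$ are repeated according to multiplicity, and the right vectors $v_i$ are orthonormal eigenvectors of $A_\mu^*A_\mu$ with eigenvalues $\sigma_i^2$.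 If there are only finitely many positive singular values, the sequence of vectors $v_i$ is continued by an orthonormal basis of $\ker A_\mu$ (with $\sigma_i=0$), and if $\dim H<\infty$ one puts $\sigma_i=0$ for $i>\dim H$. $\mathrm{Sp}$ denotes linear span. *)

(* Defs.v *)
From HB Require Import structures.
From mathcomp Require Import all_boot all_order all_algebra.
From mathcomp Require Import all_classical all_reals all_analysis.

Set Implicit Arguments.
Unset Strict Implicit.
Unset Printing Implicit Defensive.

Import Order.TTheory GRing.Theory Num.Theory.
Import numFieldNormedType.Exports.

Local Open Scope classical_set_scope.
Local Open Scope ring_scope.

(* A real Hilbert space is a complete normed module H over R : realType with a
   positive definite symmetric bilinear form dot : {dot H for idfun} such that
   dot x x = `|x| ^+ 2.  It is measured with its Borel sigma-algebra. *)
Notation borel H := (g_sigma_algebraType (@open H)).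

Definition separable (T : topologicalType) : Prop :=
  exists2 D : set T, countable D & dense D.

Section Flats.
Context {R : realType} {H : completeNormedModType R}.

Definition lin_free (n : nat) (e : 'I_n -> H) : Prop :=
  forall c : 'I_n -> R, \sum_(i < n) c i *: e i = 0 -> forall i, c i = 0.

Definition Sp (X : set H) : set H :=
  [set y | exists (n : nat) (c : 'I_n -> R) (e : 'I_n -> H),
    (forall i, X (e i)) /\ y = \sum_(i < n) c i *: e i].

Definition translate (p : H) (W : set H) : set H := [set p + w | w in W].

Definition AG (d : nat) : set (set H) :=
  [set L | exists (p : H) (e : 'I_d -> H),
    lin_free e /\ L = translate p (Sp (range e))].

Definition dist (x : H) (L : set H) : R := inf [set `|x - z| | z in L].

End Flats.

(* dim H >= n, including the infinite-dimensional case *)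
Definition dim_ge (R : realType) (H : completeNormedModType R) (n : nat) : Prop :=
  exists e : 'I_n -> H, lin_free e.

Section BochnerIntegral.
Context {d : measure_display} {T : measurableType d} {R : realType}
  {H : completeNormedModType R} (mu : probability T R).

Definition simple_fun (s : T -> H) : Prop :=
  finite_set (range s) /\ forall h, measurable (s @^-1` [set h]).

Definition simple_integral (s : T -> H) : H :=
  \sum_(h \in range s) fine (mu (s @^-1` [set h])) *: h.

Definition is_bochner_integral (f : T -> H) (m : H) : Prop :=
  exists s : nat -> T -> H,
    [/\ forall n, simple_fun (s n),
        {ae mu, forall x, s n x @[n --> \oo] --> f x},
        (\int[mu]_x `|f x - s n x|%:E)%E @[n --> \oo] --> 0%E
      & simple_integral (s n) @[n --> \oo] --> m].

Definition bochner_integral (f : T -> H) : H :=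
  xget 0 [set m | is_bochner_integral f m].

End BochnerIntegral.

Section LeastSquares.
Context {R : realType} {H : completeNormedModType R}
  (mu : probability (borel H) R).

(* the closed topological support of mu *)
Definition supp : set H :=
  [set x | forall U : set H, open_nbhs x U -> (0 < mu U)%E].

Definition center_of_mass : H := bochner_integral mu (fun x : borel H => x : H).

Definition ls_error (L : set H) : \bar R :=
  sqrte (\int[mu]_x (dist x L ^+ 2)%:E)%E.

Definition e2 (d : nat) : \bar R := ereal_inf [set ls_error L | L in AG d].

Definition is_LS_flat (d : nat) (L : set H) : Prop :=
  AG d L /\ ls_error L = e2 d.

End LeastSquares.

Section DataToFeatures.
Context {R : realType} {H : completeNormedModType R} (dot : {dot H for idfun})
  (mu : probability (borel H) R).

(* Elements of L_2(mu) are represented by functions, equality in L_2(mu) being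
   equality mu-almost everywhere.  When supp mu is bounded, the functions
   data_to_features y are square integrable. *)
Definition L2_dot (f g : borel H -> R) : R := \int[mu]_x (f x * g x).

Definition data_to_features (y : H) : borel H -> R :=
  fun x => dot y ((x : H) - center_of_mass mu).

(* The Hilbert space adjoint of A : H -> L_2(mu): adjoint A f is the vector z
   such that <A y, f> = <y, z> for all y. *)
Definition adjoint (A : H -> (borel H -> R)) (f : borel H -> R) : H :=
  xget 0 [set z | forall y, L2_dot (A y) f = dot y z].

(* A^* A for A := data_to_features *)
Definition adjoint_mul (y : H) : H :=
  adjoint data_to_features (data_to_features y).

(* sigma i and v i are 0-indexed: they stand for the singular value and the
   right vector number i.+1, and the vectors v i are only relevant for
   i < dim H, i.e., if dim_ge H i.+1; all sigma i with i >= dim H are 0. *)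
Record singular_system (sigma : nat -> R) (v : nat -> H) : Prop := {
  sigma_ge0 : forall i, 0 <= sigma i ;
  sigma_nonincreasing : nonincreasing_seq sigma ;
  sigma_dim : forall i, ~ dim_ge H i.+1 -> sigma i = 0 ;
  v_orthonormal : forall i j, dim_ge H i.+1 -> dim_ge H j.+1 ->
    dot (v i) (v j) = (i == j)%:R ;
  v_eigen : forall i, dim_ge H i.+1 -> adjoint_mul (v i) = sigma i ^+ 2 *: v i ;
  (* with A := data_to_features, every positive eigenvalue of A^* A is listed
     with its full multiplicity *)
  sigma_multiplicity : forall (lam : R) (y : H), 0 < lam ->
    adjoint_mul y = lam *: y ->
    Sp [set v i | i in [set i | dim_ge H i.+1 /\ sigma i ^+ 2 = lam]] y ;
  (* if only finitely many sigma i are positive, then the v i such that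
     sigma i = 0 form an orthonormal basis of the kernel of A *)
  v_kernel : (exists i, sigma i = 0) -> forall y,
    data_to_features y = 0 %[ae mu] ->
    closure (Sp [set v i | i in [set i | dim_ge H i.+1 /\ sigma i = 0]]) y }.

End DataToFeatures.

(* Main.v *)
Require Import Defs.
From mathcomp Require Import all_boot all_order all_algebra.
From mathcomp Require Import all_classical all_reals all_analysis.
From mathcomp Require Import finmap measurable_realfun ring lra.
Import Order.TTheory GRing.Theory Num.Theory.
Import numFieldNormedType.Exports.
Local Open Scope classical_set_scope.
Local Open Scope ring_scope.

(* Let B(y, z) be the covariance form of mu, i.e. the integral of
   <y, x - x_cm> <z, x - x_cm>, and V its trace, the integral of |x - x_cm|^2.
   For an orthonormal basis u of the direction of a flat L, the squared error of
   L is V - sum_i B(u_i, u_i) + dist(x_cm, L)^2, so an optimal flat contains x_cm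
   and maximises the trace of B over d-dimensional subspaces.  By Ky Fan's
   principle the maximum is the sum of the d largest eigenvalues, attained only
   on the span of the top eigenvectors if there is a spectral gap.

   The eigenvectors come from maximising B on the unit sphere of the orthogonal
   complement of those already found.  Instead of compactness of the operator,
   attainment uses that B has finite trace: the supremum drops after passing to
   the complement of finitely many almost maximising vectors, and then it is
   attained by a Lax-Milgram argument in codimension one. *)

(** * Symmetric bilinear forms *)

Section SymmetricForms.
Context {R : realType} {H : lmodType R}.

(** Existence of a least squares flat is claimed before any singular system is given, so top
    eigenvectors have to be constructed. The other claims concern an arbitrary singular system;
    there, the listing of every positive eigenvalue with full multiplicity is what identifies the
    [v i] as successive maximisers.

    The trace of [B] is at most [V] because Bessel's inequality can be integrated pointwise. That
    [V] is the sum of all eigenvalues, which the error formula needs, comes from approximating the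
    identity of [H] by simple functions: their values lie in finite-dimensional subspaces, on which
    the trace of [B] comes arbitrarily close to [V]. Finite orthonormal families thus suffice
    throughout.

    For uniqueness, Ky Fan's inequality carries an explicit deficit, the spectral gap times the sum
    of the squared distances of the [u j] to the span of the [v i]; optimality forces it to vanish.
    Without a gap, the last of the [d] top vectors can be exchanged for the next one. *)

Record symform (B : H -> H -> R) : Prop := {
  symfC : forall x y, B x y = B y x ;
  symfP : forall a x y z, B (a *: x + y) z = a * B x z + B y z }.

Definition psd (B : H -> H -> R) : Prop := symform B /\ forall x, 0 <= B x x.

Section Theory.
Context {B : H -> H -> R}.
Hypothesis symB : symform B.

Lemma symfDl x y z : B (x + y) z = B x z + B y z.
Proof. by rewrite -{1}(scale1r x) (symfP _ symB) mul1r. Qed.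

Lemma symf0l z : B 0 z = 0.
Proof.
by have /eqP := symfDl 0 0 z; rewrite addr0 -subr_eq subrr eq_sym => /eqP.
Qed.

Lemma symfZl a x z : B (a *: x) z = a * B x z.
Proof. by rewrite -(addr0 (a *: x)) (symfP _ symB) symf0l addr0. Qed.

Lemma symfNl x z : B (- x) z = - B x z.
Proof. by rewrite -scaleN1r symfZl mulN1r. Qed.

Lemma symfBl x y z : B (x - y) z = B x z - B y z.
Proof. by rewrite symfDl symfNl. Qed.

Lemma symfDr x y z : B z (x + y) = B z x + B z y.
Proof. by rewrite !(symfC _ symB z) symfDl. Qed.

Lemma symf0r z : B z 0 = 0.
Proof. by rewrite (symfC _ symB) symf0l. Qed.

Lemma symfZr a x z : B z (a *: x) = a * B z x.
Proof. by rewrite !(symfC _ symB z) symfZl. Qed.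

Lemma symfNr x z : B z (- x) = - B z x.
Proof. by rewrite !(symfC _ symB z) symfNl. Qed.

Lemma symfBr x y z : B z (x - y) = B z x - B z y.
Proof. by rewrite symfDr symfNr. Qed.

Lemma symf_suml (I : Type) (r : seq I) (x : I -> H) z :
  B (\sum_(i <- r) x i) z = \sum_(i <- r) B (x i) z.
Proof.
apply: (big_morph (fun x => B x z)); last exact: symf0l.
by move=> a b; rewrite symfDl.
Qed.

Lemma symf_sumr (I : Type) (r : seq I) (x : I -> H) z :
  B z (\sum_(i <- r) x i) = \sum_(i <- r) B z (x i).
Proof.
by rewrite (symfC _ symB) symf_suml; apply: eq_bigr => i _; rewrite (symfC _ symB).
Qed.

Lemma symf_sqrD x y : B (x + y) (x + y) = B x x + 2 * B x y + B y y.
Proof. rewrite symfDl !symfDr (symfC _ symB y x); lra. Qed.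

Lemma symf_sqrB x y : B (x - y) (x - y) = B x x - 2 * B x y + B y y.
Proof. rewrite symf_sqrD symfNr symfNl symfNr; lra. Qed.

Lemma symf_sqrZ a x : B (a *: x) (a *: x) = a ^+ 2 * B x x.
Proof. rewrite symfZl symfZr; ring. Qed.

End Theory.

(** Besides Cauchy-Schwarz for semidefinite forms, this turns an extremality property along every
    line [x + t *: y] into a bound on the first-order term [b]. *)
Lemma discriminant_le0 (a b c : R) : 0 <= c ->
  (forall t, 0 <= a + 2 * t * b + t ^+ 2 * c) -> b ^+ 2 <= a * c.
Proof.
move=> c0 P; have [c_eq0|c_neq0] := eqVneq c 0.
  have [->|b0] := eqVneq b 0; first by rewrite c_eq0 mulr0 expr0n.
  (* For [c = 0] the polynomial is affine, and at this [t] it equals -1. *)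
  have := P (- (a + 1) / (2 * b)); rewrite c_eq0 mulr0 addr0.
  have -> : a + 2 * (- (a + 1) / (2 * b)) * b = -1 by field.
  lra.
have {c0 c_neq0}c0 : 0 < c by rewrite lt0r c_neq0.
have := P (- b / c).
have -> : a + 2 * (- b / c) * b + (- b / c) ^+ 2 * c = (a * c - b ^+ 2) / c.
  by field; rewrite gt_eqF.
by rewrite pmulr_lge0 ?invr_gt0// subr_ge0.
Qed.

Lemma psd_CS (B : H -> H -> R) : psd B -> forall x y,
  B x y ^+ 2 <= B x x * B y y.
Proof.
move=> [symB B0] x y; apply: discriminant_le0; first exact: B0.
move=> t; have := B0 (x + t *: y).
by rewrite (symf_sqrD symB) (symf_sqrZ symB) (symfZr symB) mulrA.
Qed.

End SymmetricForms.

Lemma cauchy_sqr_cvg {R : realType} {H : completeNormedModType R} (K : R)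
    (z : nat -> H) :
  (forall m n, `|z m - z n| ^+ 2 <= K / m.+1%:R + K / n.+1%:R) ->
  exists l : H, z n @[n --> \oo] --> l.
Proof.
move=> P; suff : cauchy (z @ \oo) by move=> /cauchy_cvgP zc; exists (lim (z @ \oo)); exact: zc.
apply: (@cauchy_exP R H (z @ \oo)) => e e0.
have K0 : 0 <= K.
  by have := le_trans (sqr_ge0 _) (P 0%N 0%N); rewrite divr1; lra.
have Ke : 0 <= 2 * K / e ^+ 2 by rewrite divr_ge0 ?sqr_ge0// mulr_ge0.
have := archi_boundP Ke; set N := Num.Def.archi_bound _ => NP.
exists (z N); exists N => // n /= Nn; rewrite -ball_normE /=.
rewrite -(@ltr_pXn2r _ 2)// ?nnegrE//; last exact: ltW.
apply: (le_lt_trans (P N n)).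
have nN : K / n.+1%:R <= K / N.+1%:R.
  by rewrite ler_wpM2l// lef_pV2 ?posrE ?ltr0n// ler_nat ltnS.
apply: (le_lt_trans (lerD (lexx _) nN)).
have -> : K / N.+1%:R + K / N.+1%:R = (2 * K) / N.+1%:R by ring.
rewrite ltr_pdivrMr ?ltr0n// [_ ^+ 2 * _]mulrC -ltr_pdivrMr ?exprn_gt0//.
by rewrite (lt_le_trans NP)// ler_nat.
Qed.

(** * Minimisation of coercive forms *)

Section ClosedSubspaces.
Context {R : realType} {H : completeNormedModType R}.

(** Closedness is sequential, the form in which minimising sequences use it. *)
Definition closed_subspace (S : set H) : Prop :=
  [/\ S 0, forall a x y, S x -> S y -> S (a *: x + y) &
    forall (u : nat -> H) l, (forall n, S (u n)) -> u n @[n --> \oo] --> l -> S l].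

Lemma closed_subspaceT : closed_subspace setT.
Proof. by []. Qed.

Lemma closed_subspaceD S x y : closed_subspace S -> S x -> S y -> S (x + y).
Proof. by move=> [_ P _] Sx Sy; rewrite -(scale1r x); exact: P. Qed.

Lemma closed_subspaceZ S a x : closed_subspace S -> S x -> S (a *: x).
Proof. by move=> [S0 P _] Sx; rewrite -(addr0 (_ *: _)); exact: P. Qed.

Lemma closed_subspaceB S x y : closed_subspace S -> S x -> S y -> S (x - y).
Proof.
by move=> cS Sx Sy; apply: closed_subspaceD => //; rewrite -scaleN1r; exact: closed_subspaceZ.
Qed.

(* Minimising the energy a(z, z) - 2 f(z) over S: the parallelogram law for the
   coercive form a makes every minimising sequence Cauchy. *)
Lemma riesz_coercive (S : set H) (a : H -> H -> R) (f : H -> R) (c C K : R) :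
  closed_subspace S -> symform a -> 0 < c -> 0 <= C ->
  (forall z, S z -> c * `|z| ^+ 2 <= a z z) ->
  (forall x y, `|a x y| <= C * (`|x| * `|y|)) ->
  (forall k x y, f (k *: x + y) = k * f x + f y) ->
  (forall x, `|f x| <= K * `|x|) ->
  exists2 z, S z & forall w, S w -> a z w = f w.
Proof.
move=> cS sa c0 C0 ac aC flin fK.
have a0 w : S w -> 0 <= a w w.
  by move=> Sw; apply: le_trans (ac _ Sw); rewrite mulr_ge0 ?sqr_ge0// ltW.
have [S0 _ Scl] := cS.
have f0 : f 0 = 0.
  have := flin 1 0 0; rewrite scaler0 addr0 mul1r => /eqP.
  by rewrite -subr_eq subrr eq_sym => /eqP.
have fZ k x : f (k *: x) = k * f x by rewrite -[_ *: _]addr0 flin f0 addr0.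
have fD x y : f (x + y) = f x + f y by rewrite -{1}(scale1r x) flin mul1r.
pose J z := a z z - 2 * f z.
have Jlb z : S z -> - (K ^+ 2 / c) <= J z.
  (* Completing the square in the norm of [z] gives the bound. *)
  move=> Sz; have h1 := ac z Sz.
  have h2 : f z <= K * `|z| by apply: le_trans (fK z); exact: ler_norm.
  have h3 : 0 <= (c * `|z| - K) ^+ 2 / c by rewrite divr_ge0 ?sqr_ge0// ltW.
  have e3 : (c * `|z| - K) ^+ 2 / c = c * `|z| ^+ 2 - 2 * (K * `|z|) + K ^+ 2 / c.
    by field; rewrite gt_eqF.
  rewrite e3 in h3; rewrite /J; lra.
pose I := inf [set J z | z in S].
have hI : has_inf [set J z | z in S].
  split; first by exists (J 0); exists 0.
  by exists (- (K ^+ 2 / c)) => _ [z Sz <-]; exact: Jlb.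
have IJ z : S z -> I <= J z by move=> Sz; apply: ge_inf; [exact: hI.2|exists z].
have /choice[z zP] (n : nat) : exists z, S z /\ J z < I + n.+1%:R^-1.
  have [|_ [z Sz <-] zI] := @inf_adherent _ _ (n.+1%:R^-1) _ hI.
    by rewrite invr_gt0.
  by exists z.
have zS n := (zP n).1.
have zI n := (zP n).2.
(* The midpoint of [z m] and [z n] has energy at least [I], while both energies exceed [I] by less
   than the reciprocals; the parallelogram law doubles these excesses. *)
have zcauchy m n : c * `|z m - z n| ^+ 2 <= 2 / m.+1%:R + 2 / n.+1%:R.
  apply: (le_trans (ac _ (closed_subspaceB _ _ _ cS (zS m) (zS n)))).
  have := IJ _ (closed_subspaceZ _ 2^-1 _ cS (closed_subspaceD _ _ _ cS (zS m) (zS n))).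
  rewrite /J (symf_sqrZ sa) (symf_sqrD sa) (symf_sqrB sa) fZ fD.
  have := zI m; have := zI n; rewrite /J.
  move: (m.+1%:R^-1) (n.+1%:R^-1) => p q; lra.
have [l zl] : exists l : H, z n @[n --> \oo] --> l.
  apply: (cauchy_sqr_cvg (2 / c)) => m n.
  have -> : 2 / c / m.+1%:R + 2 / c / n.+1%:R = (2 / m.+1%:R + 2 / n.+1%:R) / c by ring.
  by rewrite ler_pdivlMr// mulrC.
have Sl : S l by apply: Scl zl.
exists l => // w Sw.
(* Along [z n + t *: w] the energy never falls below [I], so it drops by less than [n.+1%:R^-1];
   this makes [z n] nearly stationary. *)
have zw n : (a (z n) w - f w) ^+ 2 <= a w w / n.+1%:R.
  have : (a (z n) w - f w) ^+ 2 <= n.+1%:R^-1 * a w w.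
    apply: discriminant_le0 => [|t]; first exact: a0.
    have := IJ _ (closed_subspaceD _ _ _ cS (zS n) (closed_subspaceZ _ t _ cS Sw)).
    have := zI n; rewrite /J (symf_sqrD sa) (symf_sqrZ sa) (symfZr sa) fD fZ.
    move: (n.+1%:R^-1) => p; lra.
  by rewrite mulrC.
have cv1 : a (z n) w @[n --> \oo] --> a l w.
  apply/cvgrPdist_le => e e0.
  have q0 : 0 < C * `|w| + 1 by rewrite ltr_wpDl// mulr_ge0.
  have d0 : 0 < e / (C * `|w| + 1) by rewrite divr_gt0.
  near=> n.
  rewrite -(symfBl sa); apply: (le_trans (aC _ _)).
  have : `|l - z n| <= e / (C * `|w| + 1).
    by near: n; move/cvgrPdist_le : zl => /(_ _ d0).
  rewrite ler_pdivlMr// => h; apply: le_trans h.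
  by rewrite mulrCA ler_wpM2l// lerDl.
have cv2 : a (z n) w @[n --> \oo] --> f w.
  apply/cvgrPdist_le => e e0.
  have K0 : 0 <= a w w / e ^+ 2 by rewrite divr_ge0 ?sqr_ge0// a0.
  have := archi_boundP K0; set N := Num.Def.archi_bound _ => NP.
  exists N => // n /= Nn.
  rewrite distrC -(@ler_pXn2r _ 2)// ?nnegrE//; last exact: ltW.
  rewrite real_normK ?num_real//; apply: (le_trans (zw n)).
  rewrite ler_pdivrMr ?ltr0n// [_ ^+ 2 * _]mulrC -ler_pdivrMr ?exprn_gt0//.
  by rewrite (le_trans (ltW NP))// ler_nat (leq_trans Nn).
exact: (cvg_unique _ cv1 cv2).
Unshelve. all: by end_near. Qed.

End ClosedSubspaces.

(** * Orthonormal families *)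

Section Orthonormal.
Context {R : realType} {H : completeNormedModType R}.
Context {dot : H -> H -> R} (sdot : symform dot)
  (dot_norm : forall x : H, dot x x = `|x| ^+ 2).

(** Families are total functions on [nat] of which only the first [n] values matter, so truncating
    or extending one does not change its index type. *)
Definition orthonormal_fam (n : nat) (u : nat -> H) : Prop :=
  forall i j, (i < n)%N -> (j < n)%N -> dot (u i) (u j) = (i == j)%:R.

Definition span (n : nat) (u : nat -> H) : set H :=
  [set y | exists c : nat -> R, y = \sum_(i < n) c i *: u i].

Definition perp (n : nat) (u : nat -> H) : set H :=
  [set y | forall i, (i < n)%N -> dot (u i) y = 0].

Definition proj (n : nat) (u : nat -> H) (x : H) : H :=
  \sum_(i < n) dot (u i) x *: u i.

Definition extend (n : nat) (u : nat -> H) (x : H) : nat -> H :=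
  fun i => if i == n then x else u i.

Lemma dot_psd : psd dot.
Proof. by split=> // x; rewrite dot_norm sqr_ge0. Qed.

Lemma dot_eq0 x : dot x x = 0 -> x = 0.
Proof. by rewrite dot_norm => /eqP; rewrite expf_eq0/= normr_eq0 => /eqP. Qed.

Lemma dot_gt0 x : x != 0 -> 0 < dot x x.
Proof. by move=> x0; rewrite dot_norm exprn_gt0// normr_gt0. Qed.

Lemma dot_le x y : `|dot x y| <= `|x| * `|y|.
Proof.
rewrite -(@ler_pXn2r _ 2)// ?nnegrE ?mulr_ge0// real_normK ?num_real// exprMn.
by rewrite -!dot_norm; exact: psd_CS dot_psd _ _.
Qed.

Lemma normalize x : x != 0 -> dot (`|x|^-1 *: x) (`|x|^-1 *: x) = 1.
Proof.
by move=> x0; rewrite (symf_sqrZ sdot) dot_norm -exprMn mulVf ?expr1n// normr_eq0.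
Qed.

Lemma dot_continuous y : continuous (dot y).
Proof.
move=> l; apply/cvgrPdist_le => e e0; near=> x.
rewrite -(symfBr sdot); apply: le_trans (dot_le _ _) _.
have y0 : 0 < `|y| + 1 by rewrite ltr_wpDl.
have : `|l - x| <= e / (`|y| + 1).
  near: x; have := @cvg_id _ (nbhs l); move/cvgrPdist_le; apply.
  by rewrite divr_gt0.
rewrite ler_pdivlMr// mulrC => h; apply: le_trans h.
by rewrite ler_wpM2r// lerDl.
Unshelve. all: by end_near. Qed.

Lemma dot_cvg (u : nat -> H) l y : u n @[n --> \oo] --> l ->
  dot y (u n) @[n --> \oo] --> dot y l.
Proof. by move=> ul; apply: continuous_cvg ul; exact: dot_continuous. Qed.

Lemma closed_subspace_perp n u : closed_subspace (perp n u).
Proof.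
split=> [i _|a x y xP yP i ik|w l wP wl i ik]; first exact: symf0r.
  by rewrite (symfDr sdot) (symfZr sdot) xP// yP// mulr0 addr0.
have c1 := dot_cvg w l (u i) wl.
have c2 : dot (u i) (w n) @[n --> \oo] --> 0.
  have -> : (fun n => dot (u i) (w n)) = cst 0 by apply/funext => m; rewrite wP.
  exact: cvg_cst.
exact: (cvg_unique _ c1 c2).
Qed.

Lemma closed_subspaceI (S T : set H) :
  closed_subspace S -> closed_subspace T -> closed_subspace (S `&` T).
Proof.
move=> [S0 SP Sc] [T0 TP Tc]; split=> //.
  by move=> a x y [? ?] [? ?]; split; [exact: SP|exact: TP].
move=> u l uP ul; split; [apply: Sc ul|apply: Tc ul] => n; by have [] := uP n.
Qed.

Lemma orthonormalW m n u : (m <= n)%N -> orthonormal_fam n u -> orthonormal_fam m u.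
Proof. by move=> mn un i j im jm; rewrite un// (leq_trans _ mn). Qed.

Lemma perpW m n u : (m <= n)%N -> perp n u `<=` perp m u.
Proof. by move=> mn y yP i im; apply: yP; exact: leq_trans im mn. Qed.

Lemma orthonormal_extend n u x : orthonormal_fam n u -> perp n u x -> dot x x = 1 ->
  orthonormal_fam n.+1 (extend n u x).
Proof.
move=> un ux x1 i j; rewrite !ltnS /extend.
have [->|ni] := eqVneq i n; have [->|nj] := eqVneq j n => iln jln.
- by rewrite x1 ?eqxx.
- by rewrite (symfC _ sdot) ux ?eq_sym ?(negbTE nj)// ltn_neqAle nj.
- by rewrite ux ?(negbTE ni)// ltn_neqAle ni.
- by rewrite un// ltn_neqAle ?ni ?nj.
Qed.

Lemma extend_lt n u x i : (i < n)%N -> extend n u x i = u i.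
Proof. by move=> i_n; rewrite /extend ltn_eqF. Qed.

Lemma extend_eq n u x : extend n u x n = x.
Proof. by rewrite /extend eqxx. Qed.

Lemma dot_span n u (c : nat -> R) i : orthonormal_fam n u -> (i < n)%N ->
  dot (u i) (\sum_(j < n) c j *: u j) = c i.
Proof.
move=> un ilt; rewrite (symf_sumr sdot) (bigD1 (Ordinal ilt))//= big1 ?addr0.
  by rewrite (symfZr sdot) un// eqxx mulr1.
move=> j ji; rewrite (symfZr sdot) un//.
by move: ji; rewrite -val_eqE/= eq_sym => /negbTE ->; rewrite mulr0.
Qed.

Lemma span_proj n u x : span n u (proj n u x).
Proof. by exists (fun i => dot (u i) x). Qed.

Lemma proj_id n u x : orthonormal_fam n u -> span n u x -> proj n u x = x.
Proof.
by move=> un [c ->]; apply: eq_bigr => i _; rewrite dot_span.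
Qed.

Lemma perp_proj n u x : orthonormal_fam n u -> perp n u (x - proj n u x).
Proof.
by move=> un i ilt; rewrite (symfBr sdot) (dot_span n u (fun i => dot (u i) x))// subrr.
Qed.

Lemma perp_span n u x y : perp n u x -> span n u y -> dot y x = 0.
Proof.
move=> px [c ->]; rewrite (symf_suml sdot) big1// => i _.
by rewrite (symfZl sdot) px// mulr0.
Qed.

Lemma spanD n u x y : span n u x -> span n u y -> span n u (x + y).
Proof.
move=> [c ->] [e ->]; exists (c \+ e); rewrite -big_split; apply: eq_bigr => i _.
by rewrite scalerDl.
Qed.

Lemma spanZ n u a x : span n u x -> span n u (a *: x).
Proof.
move=> [c ->]; exists (fun i => a * c i); rewrite scaler_sumr; apply: eq_bigr => i _.
by rewrite scalerA.
Qed.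

Lemma spanB n u x y : span n u x -> span n u y -> span n u (x - y).
Proof. by move=> ? ?; rewrite -scaleN1r; apply: spanD => //; exact: spanZ. Qed.

Lemma span0 n u : span n u 0.
Proof. by exists (cst 0); rewrite big1// => i _; rewrite scale0r. Qed.

Lemma span_gen n u i : (i < n)%N -> span n u (u i).
Proof.
move=> ilt; exists (fun j => (j == i)%:R).
rewrite (bigD1 (Ordinal ilt))//= eqxx scale1r big1 ?addr0// => j.
by rewrite -val_eqE/= => /negbTE ->; rewrite scale0r.
Qed.

Lemma span_sub m n u w : (forall i, (i < m)%N -> span n w (u i)) ->
  span m u `<=` span n w.
Proof.
move=> uw _ [c ->]; elim/big_ind : _; [exact: span0|exact: spanD|move=> i _].
by apply: spanZ; exact: uw.
Qed.

Lemma dot_proj n u x : orthonormal_fam n u ->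
  dot (x - proj n u x) (x - proj n u x) = dot x x - \sum_(i < n) dot (u i) x ^+ 2.
Proof.
move=> un; rewrite {2}/proj (symfBl sdot).
rewrite (perp_span n u (x - proj n u x) (proj n u x)); last 2 first.
  exact: perp_proj.
  exact: span_proj.
rewrite subr0 (symfBr sdot) (symf_sumr sdot); congr (_ - _); apply: eq_bigr => i _.
by rewrite (symfZr sdot) (symfC _ sdot x) expr2.
Qed.

Lemma bessel n u x : orthonormal_fam n u -> \sum_(i < n) dot (u i) x ^+ 2 <= dot x x.
Proof. by move=> un; rewrite -subr_ge0 -dot_proj//; exact: dot_psd.2. Qed.

Lemma dot_proj_le n u x y : orthonormal_fam n u -> span n u y ->
  dot (x - proj n u x) (x - proj n u x) <= dot (x - y) (x - y).
Proof.
move=> un uy; have -> : x - y = (x - proj n u x) + (proj n u x - y).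
  by rewrite addrA subrK.
rewrite (symf_sqrD sdot (x - proj n u x)).
rewrite (symfC _ sdot _ (proj n u x - y)).
rewrite (perp_span n u (x - proj n u x) (proj n u x - y)); last 2 first.
- exact: perp_proj.
- by apply: spanB => //; exact: span_proj.
by rewrite mulr0 addr0 lerDl dot_psd.2.
Qed.

(** The rows of a matrix with fewer columns than rows are dependent. With coordinates as entries
    this bounds the size of free families in a span; with inner products as entries it produces
    orthogonal vectors. *)
Lemma nontrivial_relation m n (M : nat -> nat -> R) : (m < n)%N ->
  exists2 c : 'I_n -> R, (exists i, c i != 0) &
    forall j, (j < m)%N -> \sum_(i < n) c i * M i j = 0.
Proof.
move=> mn; pose A := \matrix_(i < n, j < m) M i j.
have : kermx A != 0.
  by rewrite -mxrank_eq0 mxrank_ker subn_eq0 -ltnNge (leq_ltn_trans (rank_leq_col A)).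
move=> /rowV0Pn[r rA r0]; exists (r 0).
  apply/existsP; apply: contraNT r0; rewrite negb_exists => /forallP r0.
  by apply/eqP/rowP => i; rewrite mxE; move: (r0 i); rewrite negbK => /eqP.
move=> j jm; have /sub_kermxP /rowP /(_ (Ordinal jm)) := rA.
by rewrite !mxE => h; rewrite -[RHS]h; apply: eq_bigr => i _; rewrite mxE.
Qed.

Lemma lin_free_le_span m n u (e : 'I_n -> H) : lin_free e ->
  (forall i, span m u (e i)) -> (n <= m)%N.
Proof.
move=> fe /choice[c cP]; rewrite leqNgt; apply/negP => mn.
pose M i j := if insub i is Some k then c k j else 0.
have [a [i ai] aM] := nontrivial_relation m n M mn.
have := fe a _ i; move=> h; move/eqP : ai; apply; apply: h.
rewrite (eq_bigr (fun k => \sum_(j < m) (a k * M k j) *: u j)); last first.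
  move=> k _; rewrite cP scaler_sumr; apply: eq_bigr => j _.
  by rewrite scalerA /M insubT//= => p; congr (_ * c _ _ *: _); apply: val_inj.
rewrite exchange_big/= big1// => j _; rewrite -scaler_suml.
by rewrite aM// scale0r.
Qed.

(** Orthogonality to [u] imposes [n] linear conditions on the combinations of [n.+1] free
    vectors. *)
Lemma unit_perp n u : dim_ge H n.+1 -> exists2 x, perp n u x & dot x x = 1.
Proof.
move=> [e fe].
pose M i j := if insub i is Some k then dot (u j) (e k) else 0.
have [c [i ci] cM] := nontrivial_relation n n.+1 M (ltnSn _).
pose x := \sum_(i < n.+1) c i *: e i.
have x0 : x != 0.
  by apply/negP => /eqP xE; move/eqP : ci; apply; exact: fe xE _.
have px : perp n u x.
  move=> j jn; rewrite (symf_sumr sdot) -[RHS](cM j jn); apply: eq_bigr => k _.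
  by rewrite (symfZr sdot) /M insubT//= => p; congr (_ * dot _ (e _)); apply: val_inj.
exists (`|x|^-1 *: x); last exact: normalize.
by apply: (closed_subspaceZ (perp n u)) => //; exact: closed_subspace_perp.
Qed.

(** The family [e] may be dependent, as for the values of a simple function: a vector with zero
    residual is dropped, whence [m] may be smaller than [n]. *)
Lemma gram_schmidt n (e : nat -> H) : exists m u,
  [/\ (m <= n)%N, orthonormal_fam m u, forall i, (i < n)%N -> span m u (e i)
    & forall i, (i < m)%N -> span n e (u i)].
Proof.
elim: n => [|n [m [u [mn um eu ue]]]].
  by exists 0%N, (cst 0); split.
have eS : span n e `<=` span n.+1 e.
  by apply: span_sub => i ilt; apply: span_gen; exact: ltnW.
pose r := e n - proj m u (e n).
have [r0|r0] := eqVneq r 0.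
  exists m, u; split=> //; first exact: leqW.
    move=> i; rewrite ltnS leq_eqVlt => /predU1P[->|/eu//].
    by move/eqP: r0; rewrite subr_eq0 => /eqP ->; exact: span_proj.
  by move=> i im; apply: eS; exact: ue.
have rS : span n.+1 e (`|r|^-1 *: r).
  apply: spanZ; apply: spanB; first exact: span_gen.
  by apply: eS; apply: (span_sub _ _ _ _ ue); exact: span_proj.
exists m.+1, (extend m u (`|r|^-1 *: r)).
have uS : span m u `<=` span m.+1 (extend m u (`|r|^-1 *: r)).
  apply: span_sub => i im; rewrite -(extend_lt m u (`|r|^-1 *: r))//.
  by apply: span_gen; exact: ltnW.
split=> //.
- apply: orthonormal_extend => //; last exact: normalize.
  by apply: (closed_subspaceZ (perp m u)); [exact: closed_subspace_perp|exact: perp_proj].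
- move=> i; rewrite ltnS leq_eqVlt => /predU1P[->|/eu/uS//].
  have -> : e n = proj m u (e n) + `|r| *: (`|r|^-1 *: r).
    by rewrite scalerA divff ?normr_eq0// scale1r addrC subrK.
  apply: spanD; first by apply: uS; exact: span_proj.
  apply: spanZ; rewrite -{2}(extend_eq m u (`|r|^-1 *: r)); exact: span_gen.
- move=> i; rewrite ltnS leq_eqVlt => /predU1P[->|im]; first by rewrite extend_eq.
  by rewrite extend_lt//; apply: eS; exact: ue.
Qed.

Lemma orthonormal_free n u : orthonormal_fam n u -> lin_free (fun i : 'I_n => u i).
Proof.
move=> un c c0 i; pose c' j := if insub j is Some k then c k else 0.
have c'E (k : 'I_n) : c' k = c k by rewrite /c' insubT//= => p; congr c; exact: val_inj.
rewrite -c'E -(dot_span n u c' i un (ltn_ord i)).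
rewrite (eq_bigr (fun j : 'I_n => c j *: u j)); last by move=> j _; rewrite c'E.
by rewrite c0 (symf0r sdot).
Qed.

(* The Bessel inequalities for u at the vectors v i sum to an equality. *)
Lemma span_orthonormal_eq n u v : orthonormal_fam n u -> orthonormal_fam n v ->
  (forall i, (i < n)%N -> span n v (u i)) -> span n u = span n v.
Proof.
move=> un vn uv; apply/seteqP; split; first exact: span_sub.
apply: span_sub => i ilt.
have S0 : \sum_(i < n) (1 - \sum_(j < n) dot (u j) (v i) ^+ 2) = 0.
  rewrite big_split/= sumrN exchange_big/= -sumrB big1// => j _.
  have := dot_proj n v (u j) vn; rewrite proj_id//; last exact: uv.
  rewrite subrr (symf0l sdot) (un _ _ (ltn_ord j) (ltn_ord j)) eqxx => h.
  rewrite [RHS]h.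
  by congr (_ - _); apply: eq_bigr => k _; rewrite (symfC _ sdot).
have nn (k : 'I_n) : 0 <= 1 - \sum_(j < n) dot (u j) (v k) ^+ 2.
  have := bessel n u (v k) un.
  by rewrite (vn _ _ (ltn_ord k) (ltn_ord k)) eqxx subr_ge0.
have /eqP := S0; rewrite psumr_eq0// => /allP/(_ (Ordinal ilt)).
rewrite mem_index_enum => /(_ isT)/eqP /= vi.
have := dot_proj n u (v i) un; rewrite (vn _ _ ilt ilt) eqxx vi => /dot_eq0/eqP.
by rewrite subr_eq0 => /eqP ->; exact: span_proj.
Qed.

End Orthonormal.

Arguments orthonormal_fam {R H} dot n u.
Arguments perp {R H} dot n u.
Arguments proj {R H} dot n u x.

(** * Trace class forms *)

Section TraceClass.
Context {R : realType} {H : completeNormedModType R}.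
Context {dot : H -> H -> R} (sdot : symform dot)
  (dot_norm : forall x : H, dot x x = `|x| ^+ 2).
Context {B : H -> H -> R} (psdB : psd B) {V : R}
  (trB : forall n u, orthonormal_fam dot n u -> \sum_(i < n) B (u i) (u i) <= V).

Let sB := psdB.1.
Let ddot := dot_psd sdot dot_norm.

Lemma trace_bound_ge0 : 0 <= V.
Proof. by have := trB 0%N (cst 0); rewrite big_ord0; apply. Qed.

Lemma form_sqr_le x : B x x <= V * `|x| ^+ 2.
Proof.
have [->|x0] := eqVneq x 0; first by rewrite (symf0l sB) normr0 expr0n mulr0.
have := trB 1%N (cst (`|x|^-1 *: x)); rewrite big_ord1/= (symf_sqrZ sB).
rewrite exprVn mulrC ler_pdivrMr ?exprn_gt0 ?normr_gt0//; apply.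
by move=> [|//] [|//] _ _; exact: normalize.
Qed.

Lemma form_le x y : `|B x y| <= V * (`|x| * `|y|).
Proof.
have V0 := trace_bound_ge0.
rewrite -(@ler_pXn2r _ 2)// ?nnegrE ?mulr_ge0// real_normK ?num_real//.
apply: le_trans (psd_CS B psdB x y) _.
have -> : (V * (`|x| * `|y|)) ^+ 2 = (V * `|x| ^+ 2) * (V * `|y| ^+ 2) by ring.
by apply: ler_pM; rewrite ?form_sqr_le// psdB.2.
Qed.

Lemma lambda_symform l : symform (fun x y => l * dot x y - B x y).
Proof.
split=> [x y|a x y z]; first by rewrite (symfC _ sdot) (symfC _ sB).
rewrite (symfP _ sdot) (symfP _ sB); ring.
Qed.

(* The form l dot - B vanishes at a minimiser y over v + (S meet v^perp), where it
   is coercive: otherwise it would be coercive on all of S. *)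
Lemma form_max_attained_aux (S : set H) (l c : R) (v : H) :
  closed_subspace S -> S v -> dot v v = 1 -> 0 < c -> 0 <= l ->
  (forall z, S z -> B z z <= l * dot z z) ->
  (forall z, S z -> dot v z = 0 -> B z z <= (l - c) * dot z z) ->
  (forall e, 0 < e -> exists2 x, S x & dot x x = 1 /\ l - e < B x x) ->
  exists2 y, S y & y != 0 /\ B y y = l * dot y y.
Proof.
move=> cS Sv v1 c0 l0 BS Bv Bsup.
have V0 := trace_bound_ge0.
pose a x y := l * dot x y - B x y.
have sa : symform a := lambda_symform l.
pose S' := S `&` perp dot 1 (cst v).
have cS' : closed_subspace S'.
  by apply: closed_subspaceI => //; exact: closed_subspace_perp.
have S'P z : S' z <-> S z /\ dot v z = 0.
  by split=> [[Sz /(_ 0%N isT)]|[Sz vz]]; split.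
have aS' z : S' z -> c * `|z| ^+ 2 <= a z z.
  by move=> /S'P[Sz vz]; have := Bv z Sz vz; rewrite /a !dot_norm; lra.
have ale x y : `|a x y| <= (l + V) * (`|x| * `|y|).
  rewrite /a; apply: le_trans (ler_normB _ _) _; rewrite mulrDl lerD ?form_le//.
  by rewrite normrM (ger0_norm l0) ler_wpM2l//; exact: dot_le.
(* Minimising [a] over [v + S']: the stationarity of [v + z] reads [a z w = - a v w] on [S']. *)
have [|||z S'z zP] := riesz_coercive S' a (fun w => - a v w) c (l + V) ((l + V) * `|v|) cS' sa c0 _ aS' ale.
- exact: addr_ge0.
- by move=> k x y; rewrite (symfDr sa) (symfZr sa); ring.
- by move=> x; rewrite normrN -mulrA.
have [Sz vz] := (S'P z).1 S'z.
pose y := v + z.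
have Sy : S y by exact: closed_subspaceD.
have vy : dot v y = 1 by rewrite /y (symfDr sdot) v1 vz addr0.
have y0 : y != 0.
  by apply/negP => /eqP yE; move: vy; rewrite yE (symf0r sdot) => /eqP; rewrite eq_sym oner_eq0.
exists y => //; split=> //.
have ay w : S' w -> a y w = 0 by move=> S'w; rewrite /y (symfDl sa) zP// subrr.
have : 0 <= a y y by rewrite subr_ge0; exact: BS.
rewrite le_eqVlt => /predU1P[|q0]; first by move=> /eqP; rewrite eq_sym subr_eq0 => /eqP.
exfalso; set q := a y y in q0.
have N0 := dot_gt0 dot_norm y y0; set N := dot y y in N0.
(* For [x = t *: y + w], the value [a x x] is at least [t ^+ 2 * q + c * dot w w]. As [y] and [w]
   need not be orthogonal for [dot], the squared norm of [x] is only bounded by twice the sum of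
   those of its parts; the halves in [e] absorb this factor, so [a x x >= e] for unit [x]. *)
pose e := Num.min (q / (2 * N)) (c / 2).
have e0 : 0 < e by rewrite lt_min !divr_gt0// mulr_gt0.
have [x Sx [x1 xe]] := Bsup e e0.
pose t := dot v x; pose w := x - t *: y.
have S'w : S' w.
  apply/S'P; split.
    by apply: (closed_subspaceB S) => //; exact: (closed_subspaceZ S).
  by rewrite /w (symfBr sdot) (symfZr sdot) vy mulr1 subrr.
have xE : x = t *: y + w by rewrite /w addrC subrK.
have axE : a x x = t ^+ 2 * q + a w w.
  by rewrite {1 2}xE (symf_sqrD sa (t *: y)) (symf_sqrZ sa) (symfZl sa) (ay w S'w) !mulr0 addr0.
have aw := aS' w S'w.
have x12 : 1 <= 2 * (t ^+ 2 * N) + 2 * dot w w.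
  have := ddot.2 (t *: y - w); have := x1.
  rewrite {1 2}xE (symf_sqrD sdot) (symf_sqrB sdot (t *: y) w) (symf_sqrZ sdot) -/N; lra.
have eN : e * (2 * N) <= q.
  by rewrite -ler_pdivlMr ?mulr_gt0// ge_min lexx.
have ec : e * 2 <= c by rewrite -ler_pdivlMr// ge_min lexx orbT.
have h1 : e * (2 * (t ^+ 2 * N)) <= t ^+ 2 * q.
  have -> : e * (2 * (t ^+ 2 * N)) = t ^+ 2 * (e * (2 * N)) by ring.
  by rewrite ler_wpM2l// sqr_ge0.
have h2 : e * (2 * dot w w) <= c * dot w w by rewrite mulrA ler_wpM2r// ddot.2.
have h3 : e * 1 <= e * (2 * (t ^+ 2 * N) + 2 * dot w w) by rewrite ler_wpM2l// ltW.
rewrite mulrDr mulr1 in h3.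
have h4 : a x x < e by rewrite /a x1; lra.
rewrite -dot_norm in aw.
rewrite axE in h4; lra.
Qed.

(* If the maximum were not attained, the supremum would survive on the orthogonal
   complement of every finite family, producing arbitrarily long orthonormal_fam
   families whose trace grows linearly. *)
Lemma form_max_attained (S : set H) : closed_subspace S ->
  (exists2 x, S x & dot x x = 1) ->
  exists y l, [/\ S y, dot y y = 1, 0 <= l, forall w, S w -> B y w = l * dot y w &
    forall w, S w -> B w w <= l * dot w w].
Proof.
move=> cS [x0 Sx0 x01].
pose E := [set B x x | x in [set x | S x /\ dot x x = 1]].
have hE : has_sup E.
  split; first by exists (B x0 x0), x0.
  exists V => _ [x [Sx x1] <-]; have := form_sqr_le x.
  by rewrite -dot_norm x1 mulr1.
pose l := sup E.
have lub x : S x -> dot x x = 1 -> B x x <= l.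
  by move=> Sx x1; apply: ub_le_sup; [exact: hE.2|exists x].
have l0 : 0 <= l by apply: le_trans (lub x0 Sx0 x01); exact: psdB.2.
have lS w : S w -> B w w <= l * dot w w.
  move=> Sw; have [->|w0] := eqVneq w 0.
    by rewrite (symf0l sB) (symf0l sdot) mulr0.
  have := lub _ (closed_subspaceZ S (`|w|^-1) w cS Sw) (normalize sdot dot_norm w w0).
  by rewrite (symf_sqrZ sB) exprVn mulrC ler_pdivrMr ?exprn_gt0 ?normr_gt0// dot_norm.
have lad e : 0 < e -> exists2 x, S x & dot x x = 1 /\ l - e < B x x.
  by move=> e0; have [_ [x [Sx x1] <-] xe] := sup_adherent e0 hE; exists x.
pose a x y := l * dot x y - B x y.
have sa : symform a := lambda_symform l.
suff [y Sy [y0 yl]] : exists2 y, S y & y != 0 /\ B y y = l * dot y y.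
  exists (`|y|^-1 *: y), l; split=> //.
  - exact: closed_subspaceZ.
  - exact: normalize.
  move=> w Sw; rewrite (symfZl sB) (symfZl sdot) mulrCA; congr (_ * _).
  (* The form [a] is semidefinite on [S] and vanishes at [y], so by Cauchy-Schwarz [a y w = 0] on
     [S], which is the eigenvector equation. *)
  have ayy : a y y = 0 by rewrite /a yl subrr.
  have : a y w ^+ 2 <= a y y * a w w.
    apply: discriminant_le0; first by rewrite subr_ge0; exact: lS.
    move=> t; have : 0 <= a (y + t *: w) (y + t *: w).
      rewrite subr_ge0; apply: lS.
      by apply: (closed_subspaceD S) => //; exact: (closed_subspaceZ S).
    by rewrite (symf_sqrD sa) (symf_sqrZ sa) (symfZr sa) mulrA.
  rewrite ayy mul0r => aw.
  have /eqP : a y w ^+ 2 = 0 by apply/le_anti; rewrite aw sqr_ge0.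
  by rewrite expf_eq0/= subr_eq0 => /eqP.
(* For [l = 0] every unit vector of [S] is a maximiser; otherwise [l / 2] is a positive amount that
   each vector of a long family adds to the trace. *)
have [l_eq0|l_neq0] := eqVneq l 0.
  exists x0 => //; split.
    by apply/negP => /eqP xE; move: x01; rewrite xE (symf0l sdot) => /eqP; rewrite eq_sym oner_eq0.
  apply/le_anti; rewrite lS//= l_eq0 mul0r; exact: psdB.2.
have {l_neq0 l0}l0 : 0 < l by rewrite lt0r l_neq0.
apply: contrapT => noy.
have big n : exists u, [/\ orthonormal_fam dot n u, forall i, (i < n)%N -> S (u i),
    forall i, (i < n)%N -> l / 2 < B (u i) (u i) &
    forall e, 0 < e -> exists2 x, (S `&` perp dot n u) x & dot x x = 1 /\ l - e < B x x].
  elim: n => [|n [u [un uS ul uad]]].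
    exists (cst 0); split=> // e /lad[x Sx xP]; exists x => //.
  have [|x [Sx ux] [x1 xl]] := uad (l / 2); first by rewrite divr_gt0.
  exists (extend n u x).
  have un1 : orthonormal_fam dot n.+1 (extend n u x) by exact: orthonormal_extend.
  split=> //.
  - move=> i; rewrite ltnS leq_eqVlt => /predU1P[->|ilt]; first by rewrite extend_eq.
    by rewrite extend_lt//; exact: uS.
  - move=> i; rewrite ltnS leq_eqVlt => /predU1P[->|ilt]; last by rewrite extend_lt//; exact: ul.
    by rewrite extend_eq; lra.
  move=> e e0; apply: contrapT => noe; apply: noy.
  (* Without such a vector, [B] would be at most [l - e] on the part of the complement orthogonal to
     [x], and the codimension-one argument would provide a maximiser. *)
  have cSu : closed_subspace (S `&` perp dot n u).
    by apply: closed_subspaceI => //; exact: closed_subspace_perp.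
  have [|||y [Sy _] yP] := form_max_attained_aux (S `&` perp dot n u) l e x cSu _ x1 e0 (ltW l0) _ _ uad.
  - by [].
  - by move=> z [Sz _]; exact: lS.
  - move=> z [Sz uz] xz; have [->|z0] := eqVneq z 0.
      by rewrite (symf0l sB) (symf0l sdot) mulr0.
    rewrite leNgt; apply/negP => zl; apply: noe.
    have puz : perp dot n.+1 (extend n u x) z.
      move=> i; rewrite ltnS leq_eqVlt => /predU1P[->|ilt]; first by rewrite extend_eq.
      by rewrite extend_lt//; exact: uz.
    exists (`|z|^-1 *: z).
      split; first exact: closed_subspaceZ.
      apply: (closed_subspaceZ (perp dot n.+1 (extend n u x))) => //.
      exact: closed_subspace_perp.
    split; first exact: normalize.
    by rewrite (symf_sqrZ sB) exprVn mulrC ltr_pdivlMr ?exprn_gt0 ?normr_gt0// -dot_norm.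
  by exists y.
have V0 := trace_bound_ge0.
have Vl : 0 <= V / (l / 2) by rewrite !divr_ge0// ltW.
(* More than [V / (l / 2)] vectors, each contributing more than [l / 2], violate the trace bound. *)
have := archi_boundP Vl; set n := Num.Def.archi_bound _.
have [u [un _ ul _]] := big n.
rewrite ltr_pdivrMr ?divr_gt0// => Vn.
have := trB n u un; rewrite leNgt => /negP; apply; apply: lt_le_trans Vn _.
have -> : n%:R * (l / 2) = \sum_(i < n) (l / 2) by rewrite sumr_const card_ord mulr_natl.
apply: ler_sum => i _; apply: ltW; exact: ul.
Qed.

(* The last clause makes l 0, .., l k.-1 the k largest eigenvalues of B in
   nonincreasing order. *)
Definition top_system (k : nat) (v : nat -> H) (l : nat -> R) : Prop :=
  [/\ orthonormal_fam dot k v,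
    forall i, (i < k)%N -> forall w, B (v i) w = l i * dot (v i) w &
    forall i, (i < k)%N -> forall w, perp dot i v w -> B w w <= l i * dot w w].

(* A maximiser over perp k v is an eigenvector on the whole space, since
   perp k v is invariant when the v i are eigenvectors. *)
Lemma top_eigenvector k v l : orthonormal_fam dot k v ->
  (forall i, (i < k)%N -> forall w, B (v i) w = l i * dot (v i) w) ->
  (exists2 x, perp dot k v x & dot x x = 1) ->
  exists y m, [/\ perp dot k v y, dot y y = 1, 0 <= m,
    forall w, B y w = m * dot y w &
    forall w, perp dot k v w -> B w w <= m * dot w w].
Proof.
move=> vk vB /(form_max_attained _ (closed_subspace_perp sdot dot_norm k v)).
move=> [y [m [vy y1 m0 ym mS]]]; exists y, m; split=> // w.
have -> : w = (w - proj dot k v w) + proj dot k v w by rewrite subrK.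
rewrite (symfDr sB) (symfDr sdot) ym; last exact: perp_proj.
rewrite mulrDr; congr (_ + _).
rewrite !(symfC _ sdot y) (perp_span sdot k v y (proj dot k v w))//; last exact: span_proj.
rewrite mulr0 /proj (symf_sumr sB) big1// => i _.
by rewrite (symfZr sB) (symfC _ sB) vB// vy// !mulr0.
Qed.

Lemma dim_geW m n : (m <= n)%N -> dim_ge H n -> dim_ge H m.
Proof.
move=> mn [e fe]; exists (e \o widen_ord mn) => c c0 i.
pose c' (j : 'I_n) := if insub (j : nat) is Some k then c k else 0.
have c'E (k : 'I_m) : c' (widen_ord mn k) = c k.
  by rewrite /c' /= insubT//= => p; congr c; exact: val_inj.
rewrite -c'E; apply: fe; rewrite -[RHS]c0.
rewrite (eq_bigr (fun i : 'I_m => c' (widen_ord mn i) *: e (widen_ord mn i))); last first.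
  by move=> j _; rewrite c'E.
rewrite (bigID (fun j : 'I_n => (j < m)%N))/= [X in _ + X]big1 ?addr0; last first.
  by move=> j jm; rewrite /c' insubF ?scale0r//; exact/negbTE.
by rewrite (big_ord_narrow mn).
Qed.

Lemma top_system_exists k : dim_ge H k -> exists v l, top_system k v l.
Proof.
elim: k => [_|k IH dk]; first by exists (cst 0), (cst 0); split.
have [v [l [vk vB vl]]] := IH (dim_geW _ _ (leqnSn k) dk).
have [y [m [vy y1 m0 ym mS]]] := top_eigenvector k v l vk vB (unit_perp sdot dot_norm k v dk).
exists (extend k v y), (fun i => if i == k then m else l i); split.
- exact: orthonormal_extend.
- move=> i; rewrite ltnS leq_eqVlt => /predU1P[->|ik].
    by rewrite extend_eq eqxx.
  by rewrite extend_lt// ltn_eqF//; exact: vB.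
- move=> i; rewrite ltnS leq_eqVlt => /predU1P[->|ik] w wP.
    by rewrite eqxx; apply: mS => j jk; rewrite -(wP j jk) extend_lt.
  rewrite ltn_eqF//; apply: vl => // j ji.
  by rewrite -(wP j ji) extend_lt//; exact: ltn_trans ik.
Qed.

Lemma top_system_val k v l i : top_system k v l -> (i < k)%N -> B (v i) (v i) = l i.
Proof. by move=> [vk vB _] ik; rewrite vB// vk// eqxx mulr1. Qed.

(** The vector [v j] is orthogonal to the first [i] vectors and so competes in the maximisation that
    defines [l i]. *)
Lemma top_system_mono k v l i j : top_system k v l -> (i <= j)%N -> (j < k)%N ->
  l j <= l i.
Proof.
move=> vP ij jk; have [vk vB vl] := vP; have ik := leq_ltn_trans ij jk.
rewrite -(top_system_val _ _ _ _ vP jk) -[leRHS]mulr1.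
have <- : dot (v j) (v j) = 1 by rewrite vk// eqxx.
apply: vl => // n ni; have nj := leq_trans ni ij.
by rewrite vk ?(ltn_trans nj)// ltn_eqF.
Qed.

(* Ky Fan's maximum principle; the second summand settles the equality case. *)
Lemma ky_fan k v l m u : top_system k.+1 v l -> m <= l k ->
  (forall w, perp dot k.+1 v w -> B w w <= m * dot w w) ->
  orthonormal_fam dot k.+1 u ->
  \sum_(j < k.+1) B (u j) (u j) + (l k - m) *
    \sum_(j < k.+1) dot (u j - proj dot k.+1 v (u j)) (u j - proj dot k.+1 v (u j))
  <= \sum_(i < k.+1) l i.
Proof.
move=> vP mlk mB uk; have [vk vB vl] := vP.
rewrite mulr_sumr -big_split/=.
(* In [x = w + p] the cross term [B p w] vanishes, since the [v i] are eigenvectors orthogonal to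
   [w]. As [dot w w] is [dot x x] minus the squared coordinates of [x], collecting the multiples of
   [l k] leaves the nonnegative coefficients [l i - l k]. *)
have H1 x : B x x + (l k - m) * dot (x - proj dot k.+1 v x) (x - proj dot k.+1 v x)
    <= l k * dot x x + \sum_(i < k.+1) (l i - l k) * dot (v i) x ^+ 2.
  set w := x - proj dot k.+1 v x; set p := proj dot k.+1 v x.
  have wP : perp dot k.+1 v w by exact: perp_proj.
  have Bw := mB w wP.
  have xE : x = w + p by rewrite /w subrK.
  have Bpw y : B p y = \sum_(i < k.+1) dot (v i) x * (l i * dot (v i) y).
    rewrite /p /proj (symf_suml sB); apply: eq_bigr => i _.
    by rewrite (symfZl sB) vB.
  have BE : B x x = B w w + \sum_(i < k.+1) l i * dot (v i) x ^+ 2.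
    rewrite {1 2}xE (symf_sqrD sB) (symfC _ sB w p) !Bpw.
    rewrite big1 ?mulr0 ?addr0; last by move=> i _; rewrite wP// !mulr0.
    congr (_ + _); apply: eq_bigr => i _.
    by rewrite /p /proj (dot_span sdot k.+1 v (fun i => dot (v i) x))//; ring.
  have wE := dot_proj sdot k.+1 v x vk; rewrite -/w in wE.
  rewrite BE; under [X in _ <= _ + X]eq_bigr do rewrite mulrBl.
  rewrite sumrB -mulr_sumr.
  have -> : \sum_(i < k.+1) dot (v i) x ^+ 2 = dot x x - dot w w by rewrite wE subKr.
  lra.
apply: (@le_trans _ _ (\sum_(j < k.+1) (l k + \sum_(i < k.+1) (l i - l k) * dot (v i) (u j) ^+ 2))).
  apply: ler_sum => j _; apply: le_trans (H1 (u j)) _.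
  by rewrite uk// eqxx mulr1.
(* With [i] fixed, Bessel's inequality for [u] at [v i] bounds the sum of squares over [j] by 1, and
   [l i - l k >= 0] preserves the bound. *)
rewrite big_split/= exchange_big/= -big_split/=; apply: ler_sum => i _.
rewrite -mulr_sumr -lerBrDl ler_piMr//.
  by rewrite subr_ge0; apply: top_system_mono vP _ _ => //; rewrite -ltnS.
have := bessel sdot dot_norm k.+1 u (v i) uk; rewrite vk// eqxx => h.
by under eq_bigr do rewrite (symfC _ sdot).
Qed.

Lemma ky_fan_le k v l u : top_system k v l -> orthonormal_fam dot k u ->
  \sum_(j < k) B (u j) (u j) <= \sum_(i < k) l i.
Proof.
case: k => [|k] vP uk; first by rewrite !big_ord0.
have := ky_fan k v l (l k) u vP (lexx _) _ uk.
rewrite subrr mul0r addr0; apply => w wP.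
have [_ _ vl] := vP; apply: (vl k (ltnSn k)); exact: (perpW k k.+1).
Qed.

End TraceClass.

Arguments top_system {R H} dot B k v l.

(** * Integration against a boundedly supported measure *)

Section BoundedlySupported.
Context {R : realType} {H : completeNormedModType R}.
Context (H_separable : separable H) (mu : probability (borel H) R)
  (mu_bounded : bounded_set (supp mu)).

(** Separability enters in this form, both to cover the complement of the support by countably many
    balls and to approximate the identity by simple functions. *)
Lemma dense_seq : exists h : nat -> H, forall x e, 0 < e ->
  exists n, `|x - h n| < e.
Proof.
have [D cD dD] := H_separable.
have /pcard_surjP[h hD] : (D #<= [set: nat])%card by [].
exists h => x e e0.
have [||y [/= xy Dy]] := dD (ball x e).
- by exists x; exact: ballxx.
- exact: ball_open.
have [n _ hn] := hD y Dy.
by exists n; move: xy; rewrite -ball_normE/= hn.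
Qed.

Lemma borel_open (U : set H) : open U -> measurable (U : set (borel H)).
Proof. exact: sub_sigma_algebra. Qed.

Lemma borel_continuous (f : H -> R) : continuous f ->
  measurable_fun setT (f : borel H -> R).
Proof.
move=> /continuousP cf.
apply: (measurability _ (RGenOpens.measurableE R)).
move=> _ [_ [a [b ->] <-]]; rewrite setTI; apply: borel_open.
exact/cf/interval_open.
Qed.

(* Lindelof: the complement of the support is covered by countably many null
   balls around points of a dense sequence. *)
Lemma ae_bounded : exists2 M : R, 0 < M & {ae mu, forall x : borel H, `|x : H| <= M}.
Proof.
have [M M0 MP] := ex_strict_bound_gt0 mu_bounded.
exists M => //; have [h hP] := dense_seq.
pose b n k : set (borel H) := ball (h n) k.+1%:R^-1.
pose F n k : set (borel H) := if pselect (mu (b n k) = 0%E) is left _ then b n k else set0.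
have mb n k : measurable (b n k) by apply: borel_open; exact: ball_open.
have nF : mu.-negligible (\bigcup_n \bigcup_k F n k).
  apply: negligible_bigcup => n; apply: negligible_bigcup => k.
  exists (F n k); split=> //; rewrite /F; case: pselect => //=.
apply: negligibleS nF => x /= /negP; rewrite -ltNge => Mx.
have : ~ supp mu x by move=> /MP /=; rewrite ltNge ltW.
move=> /existsNP[U /not_implyP[[oU Ux] /negP]]; rewrite -leNgt => muU.
have {}muU : mu U = 0%E by apply/le_anti; rewrite muU measure_ge0.
have /nbhs_ballP[e /= e0 eU] : nbhs x U by exact: open_nbhs_nbhs.
have e20 : 0 <= 2 / e by rewrite divr_ge0// ltW.
have := archi_boundP e20; set k := Num.Def.archi_bound _ => kP.
(* A ball of radius below [e / 2] that contains [x] lies in the null set [U], so it is one of the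
   null balls. *)
have ke : k.+1%:R^-1 < e / 2.
  rewrite invf_plt ?posrE ?divr_gt0// invf_div.
  by apply: lt_le_trans kP _; rewrite ler_nat.
have [n xn] := hP x k.+1%:R^-1 ltac:(by rewrite invr_gt0).
exists n => //; exists k => //; rewrite /F.
have bx : b n k x by rewrite /b -ball_normE/= distrC.
case: pselect => //; case.
apply/le_anti; rewrite measure_ge0 andbT -muU.
apply: le_measure; [exact: mem_set|apply: mem_set; exact: borel_open|].
move=> y; rewrite /b -ball_normE/= => hy; apply: eU.
rewrite -ball_normE/=; have -> : x - y = (x - h n) + (h n - y) by rewrite addrA subrK.
apply: le_lt_trans (ler_normD _ _) _.
by rewrite (splitr e); apply: ltrD; apply: lt_trans ke.
Qed.

(** Unlike integrable functions, this class is closed under products, and it contains all integrands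
    below; integrability under a probability measure is then automatic. *)
Definition ae_bounded_fun (f : borel H -> R) : Prop :=
  measurable_fun setT f /\ exists C, {ae mu, forall x, `|f x| <= C}.

Lemma ae_bounded_fun_cst c : ae_bounded_fun (cst c).
Proof. by split; [exact: measurable_cst|exists `|c|; exact: aeW]. Qed.

Lemma ae_bounded_funD f g : ae_bounded_fun f -> ae_bounded_fun g ->
  ae_bounded_fun (fun x => f x + g x).
Proof.
move=> [mf [C fC]] [mg [E gE]]; split; first exact: measurable_funD.
exists (C + E); apply: filterS2 fC gE => x fC gE.
by apply: le_trans (ler_normD _ _) _; exact: lerD.
Qed.

Lemma ae_bounded_funM f g : ae_bounded_fun f -> ae_bounded_fun g ->
  ae_bounded_fun (fun x => f x * g x).
Proof.
move=> [mf [C fC]] [mg [E gE]]; split; first exact: measurable_funM.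
exists (C * E); apply: filterS2 fC gE => x fC gE.
by rewrite normrM; exact: ler_pM.
Qed.

Lemma ae_bounded_funZ c f : ae_bounded_fun f -> ae_bounded_fun (fun x => c * f x).
Proof. move=> ?; apply: ae_bounded_funM => //; exact: ae_bounded_fun_cst. Qed.

Lemma ae_bounded_funB f g : ae_bounded_fun f -> ae_bounded_fun g ->
  ae_bounded_fun (fun x => f x - g x).
Proof.
move=> bf bg; under eq_fun do rewrite -mulN1r.
by apply: ae_bounded_funD => //; exact: ae_bounded_funZ.
Qed.

Lemma ae_bounded_fun_sum (I : Type) (r : seq I) (f : I -> borel H -> R) :
  (forall i, ae_bounded_fun (f i)) -> ae_bounded_fun (fun x => \sum_(i <- r) f i x).
Proof.
move=> bf; elim: r => [|i r IH].
  by under eq_fun do rewrite big_nil; exact: ae_bounded_fun_cst.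
by under eq_fun do rewrite big_cons; exact: ae_bounded_funD.
Qed.

Lemma ae_bounded_fun_indic (A : set (borel H)) : measurable A ->
  ae_bounded_fun (\1_A : borel H -> R).
Proof.
move=> mA; split; first exact: measurable_indic.
by exists 1; apply: aeW => x; rewrite indicE; case: (_ \in _); rewrite ?normr1 ?normr0.
Qed.

Lemma ae_bounded_fun_norm (p : H) : ae_bounded_fun (fun x : borel H => `|(x : H) - p|).
Proof.
split.
  apply: borel_continuous => x; apply: (@cvg_norm _ H).
  by apply: cvgB; [exact: cvg_id|exact: cvg_cst].
have [M M0 MP] := ae_bounded; exists (M + `|p|); apply: filterS MP => x Mx.
by rewrite normr_id; apply: le_trans (ler_normB _ _) _; rewrite lerD2r.
Qed.

Lemma ae_bounded_integrable f : ae_bounded_fun f -> mu.-integrable setT (EFin \o f).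
Proof.
move=> [mf [C fC]]; apply/integrableP; split; first exact/measurable_EFinP.
(* The almost everywhere bound [C] is not known to be nonnegative; if it is negative, 0 is a bound
   too. *)
have [|] := leP 0 C => C0.
  apply: (@le_lt_trans _ _ (C%:E * mu setT)%E); last first.
    by rewrite probability_setT mule1 ltry.
  apply: integral_le_bound => //; first exact/measurable_EFinP.
  by apply: filterS fC => x fC _; rewrite /= lee_fin.
apply: (@le_lt_trans _ _ (0%:E * mu setT)%E); last by rewrite mul0e ltry.
apply: integral_le_bound => //; first exact/measurable_EFinP.
apply: filterS fC => x fC _; rewrite /= lee_fin.
by apply: le_trans fC _; exact: ltW.
Qed.

Lemma ae_bounded_EFin_integral f : ae_bounded_fun f ->
  (\int[mu]_x (f x)%:E)%E = (\int[mu]_x f x)%:E.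
Proof.
move=> bf; rewrite /Rintegral fineK//.
by have := integrable_fin_num measurableT (ae_bounded_integrable f bf).
Qed.

Lemma ae_bounded_RintegralD f g : ae_bounded_fun f -> ae_bounded_fun g ->
  \int[mu]_x (f x + g x) = \int[mu]_x f x + \int[mu]_x g x.
Proof. by move=> bf bg; rewrite RintegralD//; exact: ae_bounded_integrable. Qed.

Lemma ae_bounded_RintegralB f g : ae_bounded_fun f -> ae_bounded_fun g ->
  \int[mu]_x (f x - g x) = \int[mu]_x f x - \int[mu]_x g x.
Proof. by move=> bf bg; rewrite RintegralB//; exact: ae_bounded_integrable. Qed.

Lemma ae_bounded_RintegralZ c f : ae_bounded_fun f ->
  \int[mu]_x (c * f x) = c * \int[mu]_x f x.
Proof. by move=> bf; rewrite RintegralZl//; exact: ae_bounded_integrable. Qed.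

Lemma Rintegral_probability_cst c : \int[mu]_x c = c.
Proof.
rewrite Rintegral_cst// [X in fine X](_ : _ = 1%E) ?mulr1//.
exact: probability_setT.
Qed.

Lemma ae_bounded_Rintegral_sum (I : Type) (r : seq I) (f : I -> borel H -> R) :
  (forall i, ae_bounded_fun (f i)) ->
  \int[mu]_x (\sum_(i <- r) f i x) = \sum_(i <- r) \int[mu]_x f i x.
Proof.
move=> bf; elim: r => [|i r IH].
  by under eq_Rintegral do rewrite big_nil; rewrite Rintegral_probability_cst big_nil.
under eq_Rintegral do rewrite big_cons.
by rewrite ae_bounded_RintegralD// ?big_cons ?IH//; exact: ae_bounded_fun_sum.
Qed.

Lemma ae_bounded_le_Rintegral f g : ae_bounded_fun f -> ae_bounded_fun g ->
  (forall x, f x <= g x) -> \int[mu]_x f x <= \int[mu]_x g x.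
Proof. by move=> bf bg fg; apply: le_Rintegral => //; exact: ae_bounded_integrable. Qed.

Section SimpleFunctions.
Context {s : borel H -> H} (ss : simple_fun s).

(** Letting [g] depend on the point as well as on the value covers [|x - s x|]; measurability then
    has to be known only for each fixed value. *)
Lemma simple_fun_expand (g : H -> borel H -> R) x :
  g (s x) x = \sum_(y <- fset_set (range s)) g y x * \1_(s @^-1` [set y]) x.
Proof.
have [fs ms] := ss.
rewrite (big_fsetD1 (s x))/=; last by rewrite in_fset_set//; apply: mem_set; exists x.
rewrite indicE mem_set// mulr1 big_seq big1 ?addr0// => y.
rewrite in_fsetD1 => /andP[/eqP ysx _]; rewrite indicE memNset ?mulr0//= => sxy.
by apply: ysx.
Qed.

Lemma ae_bounded_fun_simple (g : H -> borel H -> R) :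
  (forall y, ae_bounded_fun (g y)) -> ae_bounded_fun (fun x => g (s x) x).
Proof.
move=> bg; under eq_fun do rewrite simple_fun_expand.
apply: ae_bounded_fun_sum => y; apply: ae_bounded_funM => //.
by apply: ae_bounded_fun_indic; exact: ss.2.
Qed.

End SimpleFunctions.

End BoundedlySupported.

(** * Center of mass *)

Section CenterOfMass.
Context {R : realType} {H : completeNormedModType R}.
Context {dot : H -> H -> R} (sdot : symform dot)
  (dot_norm : forall x : H, dot x x = `|x| ^+ 2).
Context (H_separable : separable H) (mu : probability (borel H) R)
  (mu_bounded : bounded_set (supp mu)).

Let bnorm := ae_bounded_fun_norm H_separable mu mu_bounded.

Lemma ae_bounded_fun_dot y p : ae_bounded_fun mu (fun x : borel H => dot y ((x : H) - p)).
Proof.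
split.
  apply: borel_continuous => x.
  apply: (@continuous_comp _ _ _ (fun x : H => x - p) (dot y)).
    by apply: cvgB; [exact: cvg_id|exact: cvg_cst].
  exact: dot_continuous.
have [_ [C CP]] := bnorm p; exists (`|y| * C); apply: filterS CP => x.
rewrite normr_id => CP; apply: le_trans (dot_le sdot dot_norm _ _) _.
by rewrite ler_wpM2l.
Qed.

Lemma ae_bounded_fun_dot0 y : ae_bounded_fun mu (fun x : borel H => dot y (x : H)).
Proof.
have -> : (fun x : borel H => dot y (x : H)) = (fun x : borel H => dot y ((x : H) - 0)).
  by apply/funext => x; rewrite subr0.
exact: ae_bounded_fun_dot.
Qed.

Lemma ae_bounded_fun_sqr p : ae_bounded_fun mu (fun x : borel H => `|(x : H) - p| ^+ 2).
Proof. by apply: ae_bounded_funM; exact: bnorm. Qed.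

Lemma riesz (f : H -> R) (K : R) : (forall k x y, f (k *: x + y) = k * f x + f y) ->
  (forall x, `|f x| <= K * `|x|) -> exists m, forall y, dot y m = f y.
Proof.
move=> flin fK.
have [||z _ zP] := riesz_coercive setT dot f 1 1 K closed_subspaceT sdot ltr01 ler01 _ _ flin fK.
- by move=> z _; rewrite dot_norm mul1r.
- by move=> x y; rewrite mul1r; exact: dot_le.
by exists z => y; rewrite (symfC _ sdot) zP.
Qed.

Section SimpleIntegral.
Context {s : borel H -> H} (ss : simple_fun s).

Lemma ae_bounded_fun_simple_dist : ae_bounded_fun mu (fun x => `|(x : H) - s x|).
Proof.
apply: (ae_bounded_fun_simple mu ss (fun y (x : borel H) => `|(x : H) - y|)).
exact: bnorm.
Qed.

Lemma ae_bounded_fun_simple_dot y : ae_bounded_fun mu (fun x => dot y (s x)).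
Proof.
apply: (ae_bounded_fun_simple mu ss (fun z (x : borel H) => dot y z)) => z.
exact: ae_bounded_fun_cst.
Qed.

Lemma dot_simple_integral y :
  dot y (simple_integral mu s) = \int[mu]_x dot y (s x).
Proof.
have [fs ms] := ss.
rewrite /simple_integral fsbig_finite//= (symf_sumr sdot).
under eq_Rintegral do rewrite (simple_fun_expand ss (fun z _ => dot y z)).
rewrite ae_bounded_Rintegral_sum; last first.
  by move=> z; apply: ae_bounded_funZ; apply: ae_bounded_fun_indic.
apply: eq_bigr => z _; rewrite ae_bounded_RintegralZ; last exact: ae_bounded_fun_indic.
by rewrite (symfZr sdot) mulrC /Rintegral integral_indic// setIT.
Qed.

(** The factor [|y|] makes the estimate uniform over directions, which upgrades weak convergence of
    the simple integrals to convergence in norm. *)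
Lemma dot_simple_integral_dist y :
  `|dot y (simple_integral mu s) - \int[mu]_x dot y (x : H)|
  <= `|y| * \int[mu]_x `|(x : H) - s x|.
Proof.
have bs := ae_bounded_fun_simple_dot y; have b0 := ae_bounded_fun_dot0 y.
have bd := ae_bounded_fun_simple_dist.
rewrite dot_simple_integral -ae_bounded_RintegralB// -ae_bounded_RintegralZ//.
apply: le_trans (le_normr_Rintegral _ _) _ => //.
  by apply: ae_bounded_integrable; exact: ae_bounded_funB.
apply: ae_bounded_le_Rintegral.
- have [mf [C CP]] := ae_bounded_funB mu _ _ bs b0.
  split; first exact: measurableT_comp.
  by exists C; apply: filterS CP => x; rewrite normr_id.
- exact: ae_bounded_funZ.
- by move=> x; rewrite -(symfBr sdot) -[X in _ * X]normrN opprB; exact: dot_le.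
Qed.

End SimpleIntegral.

(** Choosing nearest points among ever more points keeps the error below the distance to the initial
    point [p], which serves as dominating function. The sequence is used for the Bochner integral
    and again to approximate the trace. *)
Lemma nearest_point_approximation : exists (s : nat -> borel H -> H) (p : H),
  [/\ forall n, simple_fun (s n),
      forall n (x : borel H), `|(x : H) - s n x| <= `|(x : H) - p| &
      forall x : borel H, `|(x : H) - s n x| @[n --> \oo] --> (0 : R)].
Proof.
have [h hP] := dense_seq H_separable.
(* s n x is the point nearest to x among h 0, .., h n. *)
pose s := fix s n (x : borel H) : H := if n is k.+1
  then if `|(x : H) - h k.+1| < `|(x : H) - s k x| then h k.+1 else s k x else h 0%N.
have sS n x : s n.+1 x =
  if `|(x : H) - h n.+1| < `|(x : H) - s n x| then h n.+1 else s n x by [].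
have s0E : s 0%N = cst (h 0%N) by [].
clearbody s.
have s_le n k x : (k <= n)%N -> `|(x : H) - s n x| <= `|(x : H) - h k|.
  elim: n => [|n IH]; first by rewrite leqn0 s0E => /eqP ->.
  rewrite leq_eqVlt sS => /predU1P[->|]; first by case: ltP => // /ltW.
  by rewrite ltnS => /IH kn; case: ltP => // h1; apply: le_trans kn; exact: ltW.
have sfin n : range (s n) `<=` h @` `I_n.+1.
  move=> _ [x _ <-]; elim: n => [|n [k kn hk]]; first by exists 0%N; rewrite ?s0E.
  rewrite sS; case: ifP => _; first by exists n.+1 => /=.
  by exists k => //=; exact: leq_trans kn _.
have sfun n : simple_fun (s n).
  split.
    by apply: sub_finite_set (sfin n) _; apply: finite_image; exact: finite_II.
  elim: n => [|n IH] y.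
    by rewrite s0E preimage_cst; case: ifP.
  have sn : simple_fun (s n).
    split=> //; apply: sub_finite_set (sfin n) _; apply: finite_image; exact: finite_II.
  pose A := [set x : borel H | `|(x : H) - h n.+1| < `|(x : H) - s n x|].
  have mA : measurable A.
    rewrite -[A]setTI; apply: (@measurable_fun_ltr _ _ _ _ (fun x : borel H => `|(x : H) - h n.+1|) (fun x : borel H => `|(x : H) - s n x|) _ _ _ [set true]) => //.
      exact: (bnorm _).1.
    exact: (ae_bounded_fun_simple_dist sn).1.
  have -> : s n.+1 @^-1` [set y] =
      (A `&` (cst (h n.+1) @^-1` [set y])) `|` (~` A `&` (s n @^-1` [set y])).
    apply/seteqP; split=> x /=; rewrite /A/= sS.
      by case: ifP => xA xy; [left|right]; split=> //; apply/negP/negbT.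
    by move=> [[-> //]|[/negP/negbTE -> //]].
  apply: measurableU; apply: measurableI => //; first by rewrite preimage_cst; case: ifP.
  exact: measurableC.
exists s, (h 0%N); split=> //.
  by move=> n x; exact: s_le.
move=> x; apply/cvgrPdist_le => e e0; have [k xk] := hP x e e0.
exists k => // n /= kn; rewrite sub0r normrN normr_id.
by apply: le_trans (ltW xk); exact: s_le.
Qed.

Lemma Rintegral_dominated_cvg0 (f : nat -> borel H -> R) (g : borel H -> R) :
  (forall n, ae_bounded_fun mu (f n)) -> ae_bounded_fun mu g ->
  (forall n x, 0 <= f n x <= g x) ->
  (forall x, f n x @[n --> \oo] --> (0 : R)) ->
  \int[mu]_x f n x @[n --> \oo] --> (0 : R).
Proof.
move=> bf bg fg f0.
have [|||||_ _] := @dominated_convergence _ _ _ mu setT measurableT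
  (fun n x => (f n x)%:E) (cst 0%E) (EFin \o g).
- by move=> n; apply/measurable_EFinP; exact: (bf n).1.
- exact: measurable_cst.
- by apply: aeW => x _; apply: cvg_EFin; [exact: nearW|exact: f0].
- exact: ae_bounded_integrable.
- apply: aeW => x n _ /=; rewrite lee_fin ger0_norm; last by have /andP[] := fg n x.
  by have /andP[] := fg n x.
rewrite integral0.
have -> : (fun n => \int[mu]_x (f n x)%:E)%E = EFin \o (fun n => \int[mu]_x f n x).
  by apply/funext => n /=; rewrite ae_bounded_EFin_integral.
by move/fine_cvgP => [_].
Qed.

(** Riesz representation supplies the weak integral [m], and the simple integrals are then shown to
    converge to it in norm. *)
Lemma is_bochner_integral_center : exists m,
  is_bochner_integral mu (fun x : borel H => x : H) m.
Proof.
have [s [p [sS sp s0]]] := nearest_point_approximation.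
have [m mP] : exists m, forall y, dot y m = \int[mu]_x dot y (x : H).
  apply: (riesz (fun y => \int[mu]_x dot y (x : H)) (\int[mu]_x `|(x : H) - 0|)).
    move=> k x y; rewrite -ae_bounded_RintegralZ -?ae_bounded_RintegralD.
    - by apply: eq_Rintegral => z _; rewrite (symfP _ sdot).
    - by apply: ae_bounded_funZ; exact: ae_bounded_fun_dot0.
    - exact: ae_bounded_fun_dot0.
    - exact: ae_bounded_fun_dot0.
  move=> y; have b0 := ae_bounded_fun_dot0 y.
  apply: le_trans (le_normr_Rintegral _ _) _ => //; first exact: ae_bounded_integrable.
  rewrite mulrC -ae_bounded_RintegralZ//.
  apply: ae_bounded_le_Rintegral; last by move=> x; rewrite subr0; exact: dot_le.
    have [mf [C CP]] := b0.
    split; first exact: measurableT_comp.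
    by exists C; apply: filterS CP => x; rewrite normr_id.
  exact: ae_bounded_funZ.
have I0 : \int[mu]_x `|(x : H) - s n x| @[n --> \oo] --> (0 : R).
  apply: (Rintegral_dominated_cvg0 _ (fun x : borel H => `|(x : H) - p|)) => //.
    by move=> n; exact: ae_bounded_fun_simple_dist.
  by move=> n x; rewrite normr_ge0 sp.
exists m, s; split=> //.
- apply: aeW => x; apply/cvgrPdist_le => e e0.
  have /cvgrPdist_le/(_ e e0) := s0 x; apply: filterS => n.
  by rewrite sub0r normrN normr_id.
- have -> : (fun n => \int[mu]_x `|(x : H) - s n x|%:E)%E =
      EFin \o (fun n => \int[mu]_x `|(x : H) - s n x|).
    apply/funext => n /=; rewrite -ae_bounded_EFin_integral//.
    exact: ae_bounded_fun_simple_dist.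
  by apply: cvg_EFin; [exact: nearW|exact: I0].
apply/cvgrPdist_le => e e0.
move/cvgrPdist_le : I0 => /(_ e e0); apply: filterS => n.
rewrite sub0r normrN ger0_norm; last exact: Rintegral_ge0.
apply: le_trans; pose z := simple_integral mu (s n) - m.
rewrite distrC -/z; have [->|z0] := eqVneq z 0.
  by rewrite normr0; apply: Rintegral_ge0.
(* The error vector [z] is tested against itself and one factor [|z|] is cancelled. *)
rewrite -(@ler_pM2l _ `|z|) ?normr_gt0// -expr2 -dot_norm.
rewrite {2}/z (symfBr sdot) mP; apply: le_trans (ler_norm _) _.
exact: dot_simple_integral_dist.
Qed.

(** The center of mass is a chosen Bochner integral, with its own unknown approximating sequence;
    existence rules out the default value 0, and any such sequence determines the inner products. *)
Lemma dot_center_of_mass y :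
  dot y (center_of_mass mu) = \int[mu]_x dot y (x : H).
Proof.
have [m0 m0P] := is_bochner_integral_center.
have /= [s [sS _ s0 sm]] : is_bochner_integral mu (fun x : borel H => x : H) (center_of_mass mu).
  rewrite /center_of_mass /bochner_integral; case: xgetP => [x -> //|].
  by move=> /(_ m0).
have I0 : \int[mu]_x `|(x : H) - s n x| @[n --> \oo] --> (0 : R).
  have : (fun n => \int[mu]_x `|(x : H) - s n x|%:E)%E =
      EFin \o (fun n => \int[mu]_x `|(x : H) - s n x|).
    apply/funext => n /=; rewrite -ae_bounded_EFin_integral//.
    exact: ae_bounded_fun_simple_dist.
  move=> E; move: s0; rewrite E.
  by move/fine_cvgP => [_].
have c1 := dot_cvg sdot dot_norm _ _ y sm.
have c2 : dot y (simple_integral mu (s n)) @[n --> \oo] --> \int[mu]_x dot y (x : H).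
  have y0 : 0 < `|y| + 1 by rewrite ltr_wpDl.
  apply/cvgrPdist_le => e e0.
  move/cvgrPdist_le : I0 => /(_ (e / (`|y| + 1))); rewrite divr_gt0// => /(_ isT).
  apply: filterS => n; rewrite sub0r normrN ger0_norm; last exact: Rintegral_ge0.
  rewrite ler_pdivlMr// mulrC distrC; apply: le_trans.
  apply: le_trans (dot_simple_integral_dist (sS n) y) _.
  by rewrite ler_wpM2r ?lerDl//; exact: Rintegral_ge0.
exact: (cvg_unique _ c1 c2).
Qed.

End CenterOfMass.

(** * Covariance form and errors of flats *)

Section Covariance.
Context {R : realType} {H : completeNormedModType R}.
Context {dot : H -> H -> R} (sdot : symform dot)
  (dot_norm : forall x : H, dot x x = `|x| ^+ 2).
Context (H_separable : separable H) (mu : probability (borel H) R)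
  (mu_bounded : bounded_set (supp mu)).

Let bdot := ae_bounded_fun_dot sdot dot_norm H_separable mu mu_bounded.
Let bsqr := ae_bounded_fun_sqr H_separable mu mu_bounded.

Let m := center_of_mass mu.

(** By unfolding, this is [L2_dot] of the features of [y] and [z], i.e. the bilinear form of [A^* A]
    for [A := data_to_features]. *)
Definition covariance_form (y z : H) : R :=
  \int[mu]_x (dot y ((x : H) - m) * dot z ((x : H) - m)).

Definition total_variance : R := \int[mu]_x `|(x : H) - m| ^+ 2.

Lemma ae_bounded_fun_sum_sqr n (u : nat -> H) p :
  ae_bounded_fun mu (fun x : borel H => \sum_(i < n) dot (u i) ((x : H) - p) ^+ 2).
Proof.
apply: ae_bounded_fun_sum => i.
exact: (ae_bounded_funM mu _ _ (bdot (u i) p) (bdot (u i) p)).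
Qed.

Lemma Rintegral_dot_centered y : \int[mu]_x dot y ((x : H) - m) = 0.
Proof.
under eq_Rintegral do rewrite (symfBr sdot).
rewrite ae_bounded_RintegralB ?Rintegral_probability_cst; last 2 first.
- exact: ae_bounded_fun_dot0.
- exact: ae_bounded_fun_cst.
by rewrite -(dot_center_of_mass sdot dot_norm H_separable mu mu_bounded) subrr.
Qed.

Lemma covariance_symform : symform covariance_form.
Proof.
split=> [x y|a x y z]; first by apply: eq_Rintegral => w _; rewrite mulrC.
rewrite /covariance_form -ae_bounded_RintegralZ -?ae_bounded_RintegralD.
- by apply: eq_Rintegral => w _; rewrite (symfP _ sdot); ring.
- by apply: ae_bounded_funZ; apply: ae_bounded_funM; exact: bdot.
- by apply: ae_bounded_funM; exact: bdot.
- by apply: ae_bounded_funM; exact: bdot.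
Qed.

Lemma covariance_psd : psd covariance_form.
Proof.
split; first exact: covariance_symform.
by move=> x; apply: Rintegral_ge0 => w _; rewrite -expr2 sqr_ge0.
Qed.

Lemma sum_covariance n (u : nat -> H) : \sum_(i < n) covariance_form (u i) (u i) =
  \int[mu]_x \sum_(i < n) dot (u i) ((x : H) - m) ^+ 2.
Proof.
by rewrite ae_bounded_Rintegral_sum// => i; apply: ae_bounded_funM; exact: bdot.
Qed.

Lemma covariance_trace n u : orthonormal_fam dot n u ->
  \sum_(i < n) covariance_form (u i) (u i) <= total_variance.
Proof.
move=> un; rewrite sum_covariance; apply: ae_bounded_le_Rintegral => [| |x].
- exact: ae_bounded_fun_sum_sqr.
- exact: bsqr.
- by rewrite -dot_norm; exact: (bessel sdot dot_norm).
Qed.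

(** For [u] spanning the values of a simple function, the residual of [x - m] after projection is no
    longer than the approximation error [x - s k x], whose mean square is small. *)
Lemma covariance_trace_approx e : 0 < e -> exists n u,
  orthonormal_fam dot n u /\ total_variance - e <= \sum_(i < n) covariance_form (u i) (u i).
Proof.
move=> e0.
have [s [p [sS sp s0]]] := nearest_point_approximation H_separable mu mu_bounded.
have bs n : ae_bounded_fun mu (fun x => `|(x : H) - s n x| ^+ 2).
  have h := ae_bounded_fun_simple_dist H_separable mu mu_bounded (sS n).
  exact: (ae_bounded_funM mu _ _ h h).
have I0 : \int[mu]_x `|(x : H) - s n x| ^+ 2 @[n --> \oo] --> (0 : R).
  apply: (Rintegral_dominated_cvg0 mu _ (fun x : borel H => `|(x : H) - p| ^+ 2)) => //.
    by move=> n x; rewrite sqr_ge0/= ler_pXn2r ?nnegrE.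
  by move=> x; rewrite -(mulr0 0); under eq_fun do rewrite expr2; exact: cvgM.
move/cvgrPdist_le : I0 => /(_ e e0) [k _ /(_ k (leqnn _))].
rewrite sub0r normrN ger0_norm; last by apply: Rintegral_ge0 => x _; rewrite sqr_ge0.
(* The center [m] is included so that the differences [s k x - m] lie in the span. *)
move=> ske; pose l := m :: fset_set (range (s k)).
have [n [u [_ un lu _]]] := gram_schmidt sdot dot_norm (size l) (nth 0 l).
have ul y : y \in l -> span n u y.
  by move=> yl; rewrite -(nth_index 0 yl); apply: lu; rewrite index_mem.
exists n, u; split=> //; rewrite lerBlDl -lerBlDr; apply: le_trans ske.
have bS := ae_bounded_fun_sum_sqr n u m.
rewrite sum_covariance -ae_bounded_RintegralB//.
apply: ae_bounded_le_Rintegral => //; first exact: ae_bounded_funB.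
move=> x; rewrite -!dot_norm -(dot_proj sdot n u)//.
have -> : (x : H) - s k x = (x : H) - m - (s k x - m) by rewrite opprB addrA subrK.
apply: (dot_proj_le sdot dot_norm) => //; apply: spanB; apply: ul; last by rewrite /l mem_head.
rewrite /l in_cons in_fset_set; last exact: (sS k).1.
by apply/orP; right; apply: mem_set; exists x.
Qed.

Lemma dist_flat n u p x : orthonormal_fam dot n u ->
  dist x (translate p (span n u)) ^+ 2 =
  dot (x - p) (x - p) - \sum_(i < n) dot (u i) (x - p) ^+ 2.
Proof.
move=> un; rewrite -(dot_proj sdot)// dot_norm; congr (_ ^+ 2).
set w := x - p - _; rewrite /dist; apply/le_anti/andP; split.
  apply: ge_inf.
    by exists 0 => _ [z _ <-].
  exists (p + proj dot n u (x - p)); last by rewrite /w opprD addrA.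
  by exists (proj dot n u (x - p)) => //; exact: span_proj.
apply: lb_le_inf.
  by exists `|x - (p + 0)|, (p + 0) => //; exists 0 => //; exact: span0.
move=> _ [_ [z uz <-] <-]; rewrite -(@ler_pXn2r _ 2)// ?nnegrE// -!dot_norm.
by rewrite opprD addrA; exact: (dot_proj_le sdot dot_norm).
Qed.

(* The last term is the squared distance of the center of mass to the flat. *)
Lemma ls_error_flat n u p : orthonormal_fam dot n u ->
  ls_error mu (translate p (span n u)) =
  sqrte (total_variance - \sum_(i < n) covariance_form (u i) (u i) +
         dot (m - p - proj dot n u (m - p)) (m - p - proj dot n u (m - p)))%:E.
Proof.
move=> un; rewrite /ls_error; congr sqrte.
under eq_integral => x _ do rewrite dist_flat//.
pose q := m - p.
have xp (x : borel H) : (x : H) - p = ((x : H) - m) + q by rewrite /q addrA subrK.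
(* Everything that depends linearly on [x - m] is gathered in the last summand, whose integral is
   0. *)
have E (x : borel H) : dot ((x : H) - p) ((x : H) - p) -
    \sum_(i < n) dot (u i) ((x : H) - p) ^+ 2 =
    (`|(x : H) - m| ^+ 2 - \sum_(i < n) dot (u i) ((x : H) - m) ^+ 2 +
     dot (q - proj dot n u q) (q - proj dot n u q)) +
    dot (2 *: (q - proj dot n u q)) ((x : H) - m).
  rewrite xp (symf_sqrD sdot ((x : H) - m)) (dot_proj sdot)// -dot_norm.
  rewrite (symfZl sdot) (symfBl sdot q) /proj (symf_suml sdot).
  under [X in _ = _ + _ * (_ - X)]eq_bigr do rewrite (symfZl sdot).
  rewrite (_ : \sum_(i < n) dot (u i) (x - m + q) ^+ 2 =
    \sum_(i < n) dot (u i) (x - m) ^+ 2 + \sum_(i < n) dot (u i) q ^+ 2 +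
    2 * \sum_(i < n) dot (u i) q * dot (u i) (x - m)); last first.
    rewrite mulr_sumr -!big_split; apply: eq_bigr => i _ /=.
    by rewrite (symfDr sdot (x - m)); ring.
  rewrite (symfC _ sdot (x - m) q); ring.
under eq_integral => x _ do rewrite E.
have b1 : ae_bounded_fun mu (fun x : borel H => `|(x : H) - m| ^+ 2) by exact: bsqr.
have b2 := ae_bounded_fun_sum_sqr n u m.
have b12 := ae_bounded_funB mu _ _ b1 b2.
have b3 := ae_bounded_fun_cst mu (dot (q - proj dot n u q) (q - proj dot n u q)).
have b123 := ae_bounded_funD mu _ _ b12 b3.
have b4 := bdot (2 *: (q - proj dot n u q)) m.
rewrite ae_bounded_EFin_integral; last exact: ae_bounded_funD.
rewrite ae_bounded_RintegralD// Rintegral_dot_centered addr0.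
rewrite ae_bounded_RintegralD// Rintegral_probability_cst.
by rewrite ae_bounded_RintegralB// sum_covariance.
Qed.

End Covariance.

Arguments covariance_form {R H} dot mu y z.

(** * Flats described by orthonormal families *)

Section AffineFlats.
Context {R : realType} {H : completeNormedModType R}.
Context {dot : H -> H -> R} (sdot : symform dot)
  (dot_norm : forall x : H, dot x x = `|x| ^+ 2).

Lemma Sp_span n (u : nat -> H) : Sp [set u i | i in [set i | (i < n)%N]] = span n u.
Proof.
apply/seteqP; split=> y.
  move=> [k [c [e [eu ->]]]].
  elim/big_ind : _; [exact: span0|exact: spanD|move=> i _].
  by apply: spanZ; have [j jn <-] := eu i; exact: span_gen.
move=> [c ->]; exists n, (fun i => c i), (fun i => u i); split=> // i.
by exists (i : nat) => /=.
Qed.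

Lemma Sp_subspan (X : set H) n u : (forall x, X x -> span n u x) -> Sp X `<=` span n u.
Proof.
move=> Xu _ [k [c [e [eX ->]]]].
elim/big_ind : _; [exact: span0|exact: spanD|move=> i _].
by apply: spanZ; apply: Xu; exact: eX.
Qed.

(** Gram-Schmidt drops no vector here: a free family of [d] vectors does not fit into the span of
    fewer. *)
Lemma AG_orthonormal d (L : set H) : AG d L <->
  exists p u, orthonormal_fam dot d u /\ L = translate p (span d u).
Proof.
split=> [[p [e [fe ->]]]|[p [u [ud ->]]]]; last first.
  exists p, (fun i : 'I_d => u i); split; first exact: (orthonormal_free sdot d u ud).
  congr translate; rewrite -Sp_span; congr Sp; apply/seteqP; split.
    by move=> _ [i /= ilt <-]; exists (Ordinal ilt).
  by move=> _ [i _ <-]; exists (i : nat) => /=.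
pose e' j := if insub j is Some k then e k else 0.
have e'E (k : 'I_d) : e' k = e k by rewrite /e' insubT//= => q; congr e; exact: val_inj.
have [n [u [nd un eu ue]]] := gram_schmidt sdot dot_norm d e'.
have nE : n = d.
  apply/eqP; rewrite eqn_leq nd/=; apply: (lin_free_le_span n d u e fe) => i.
  by rewrite -e'E; exact: eu.
subst n; exists p, u; split=> //; congr translate.
have -> : range e = [set e' i | i in [set i | (i < d)%N]].
  apply/seteqP; split.
    by move=> _ [i _ <-]; exists (i : nat) => //=; rewrite e'E.
  by move=> _ [i /= ilt <-]; exists (Ordinal ilt) => //; rewrite -e'E.
by rewrite Sp_span; apply/seteqP; split; apply: span_sub.
Qed.

End AffineFlats.

(** * Singular systems *)

Lemma dot_symform {R : realType} {H : completeNormedModType R}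
  (dot : {dot H for idfun}) : symform (dot : H -> H -> R).
Proof.
split=> [x y|a x y z]; first by rewrite hermitian_subproof/= expr0 mul1r.
by rewrite linearDl linearZl_LR.
Qed.

Section SingularSystem.
Context {R : realType} {H : completeNormedModType R} (dot : {dot H for idfun})
  (dot_norm : forall x : H, dot x x = `|x| ^+ 2) (H_separable : separable H)
  (mu : probability (borel H) R) (mu_bounded : bounded_set (supp mu)).

Let sdot : symform (dot : H -> H -> R) := dot_symform dot.
Let m : H := center_of_mass mu.
Let B : H -> H -> R := covariance_form dot mu.
Let V : R := total_variance mu.
Let psdB : psd B := covariance_psd sdot dot_norm H_separable mu mu_bounded.
Let trB : forall n u, orthonormal_fam dot n u -> \sum_(i < n) B (u i) (u i) <= V :=
  covariance_trace sdot dot_norm H_separable mu mu_bounded.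

(** The adjoint is a chosen vector with default 0; Riesz representation for the bounded form [B]
    shows that a vector with the defining property exists. *)
Lemma dot_adjoint_mul y z : dot z (adjoint_mul dot mu y) = B z y.
Proof.
have [w wP] : exists w, forall z, dot z w = B z y.
  apply: (riesz sdot dot_norm (fun z => B z y) (V * `|y|)).
    by move=> k a b; rewrite (symfP _ psdB.1).
  by move=> x; rewrite -mulrA (mulrC `|y|); exact: (form_le sdot dot_norm psdB trB).
rewrite /adjoint_mul /adjoint; case: xgetP => [x -> xP|]; first by rewrite -xP.
by move=> /(_ w) []; move=> x; rewrite wP.
Qed.

Lemma ls_error_top k v l : top_system dot B k v l ->
  ls_error mu (translate m (span k v)) = sqrte (V - \sum_(i < k) l i)%:E.
Proof.
move=> vP; have [vk _ _] := vP.
rewrite (ls_error_flat sdot dot_norm H_separable mu mu_bounded)//.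
rewrite subrr (proj_id sdot) //; last exact: span0.
rewrite subr0 (symf0l sdot) addr0; congr (sqrte (V - _)%:E).
by apply: eq_bigr => i _; apply: (top_system_val _ _ _ _ vP).
Qed.

Lemma ls_error_ge k v l L : top_system dot B k v l -> AG k L ->
  (sqrte (V - \sum_(i < k) l i)%:E <= ls_error mu L)%E.
Proof.
move=> vP /(AG_orthonormal sdot dot_norm)[p [u [uk ->]]].
rewrite (ls_error_flat sdot dot_norm H_separable mu mu_bounded)//.
have [_ dot0] := dot_psd sdot dot_norm.
rewrite lee_sqrt lee_fin.
  have := ky_fan_le sdot dot_norm psdB k v l u vP uk.
  have := dot0 (m - p - proj dot k u (m - p)); rewrite -/m -/B -/V; lra.
by rewrite addr_ge0// subr_ge0; exact: trB.
Qed.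

Lemma top_system_LS k v l : top_system dot B k v l ->
  e2 mu k = sqrte (V - \sum_(i < k) l i)%:E /\ is_LS_flat mu k (translate m (span k v)).
Proof.
move=> vP; have [vk _ _] := vP.
have LAG : AG k (translate m (span k v)).
  by apply/(AG_orthonormal sdot dot_norm); exists m, v.
have e2E : e2 mu k = sqrte (V - \sum_(i < k) l i)%:E.
  apply/le_anti/andP; split.
    by apply: ereal_inf_lbound; exists (translate m (span k v)) => //; exact: ls_error_top.
  by apply: le_ereal_inf_tmp => _ [L LA <-]; exact: ls_error_ge vP LA.
by split=> //; split=> //; rewrite e2E; exact: ls_error_top.
Qed.

Section Singular.
Context {sigma : nat -> R} {v : nat -> H} (sv : singular_system dot mu sigma v).

Lemma singular_orthonormal k : dim_ge H k -> orthonormal_fam dot k v.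
Proof.
by move=> dk i j ik jk; apply: (v_orthonormal sv); apply: dim_geW dk.
Qed.

Lemma singular_eigen i w : dim_ge H i.+1 -> B (v i) w = sigma i ^+ 2 * dot (v i) w.
Proof.
move=> di; rewrite (symfC _ psdB.1) -dot_adjoint_mul (v_eigen sv di).
by rewrite (symfZr sdot) (symfC _ sdot).
Qed.

(* A maximiser with a larger value would be an eigenvector for an eigenvalue
   that is only listed among the first n ones, hence in the span of v 0 .. v n.-1. *)
Lemma singular_max n w : dim_ge H n -> perp dot n v w ->
  B w w <= sigma n ^+ 2 * dot w w.
Proof.
move=> dn vw; have [->|w0] := eqVneq w 0.
  by rewrite (symf0l psdB.1) (symf0l sdot) mulr0.
have vn := singular_orthonormal n dn.
have [||y [l [vy y1 l0 yl lS]]] := top_eigenvector sdot dot_norm psdB trB n v (fun i => sigma i ^+ 2) vn.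
- by move=> i ilt z; apply: singular_eigen; exact: dim_geW dn.
- exists (`|w|^-1 *: w); last exact: normalize.
  apply: (closed_subspaceZ (perp dot n v)) => //.
  exact: (closed_subspace_perp sdot dot_norm).
apply: le_trans (lS w vw) _.
rewrite ler_wpM2r ?(dot_psd sdot dot_norm).2// leNgt; apply/negP => sl.
have l_gt0 : 0 < l by apply: le_lt_trans sl; exact: sqr_ge0.
have yE : adjoint_mul dot mu y = l *: y.
  apply/eqP; rewrite -subr_eq0; apply/eqP; apply: (dot_eq0 dot_norm).
  set r := _ - _; rewrite {2}/r (symfBr sdot) dot_adjoint_mul (symfC _ psdB.1).
  by rewrite yl (symfZr sdot) (symfC _ sdot y) subrr.
have yS : span n v y.
  apply: Sp_subspan (sigma_multiplicity sv l_gt0 yE) => _ [i [di si] <-].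
  apply: span_gen; rewrite ltnNge; apply/negP => ni.
  have := sigma_nonincreasing sv ni => sin.
  move: sl; rewrite -si ltNge => /negP; apply.
  by rewrite ler_pXn2r// ?nnegrE (sigma_ge0 sv).
have := perp_span sdot n v y y vy yS; rewrite y1 => /eqP; by rewrite oner_eq0.
Qed.

Lemma singular_top k : dim_ge H k ->
  top_system dot B k v (fun i => sigma i ^+ 2).
Proof.
move=> dk; split=> [|i ik w|i ik w vw].
- exact: singular_orthonormal.
- by apply: singular_eigen; exact: dim_geW dk.
- by apply: singular_max => //; apply: dim_geW dk; exact: ltnW.
Qed.

Lemma singular_sum_le n : \sum_(i < n) sigma i ^+ 2 <= V.
Proof.
elim: n => [|n IH]; first by rewrite big_ord0; exact: (trace_bound_ge0 trB).
have [dn|dn] := pselect (dim_ge H n.+1).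
  have vP := singular_top n.+1 dn; have [vn _ _] := vP.
  apply: le_trans (trB _ _ vn); apply: ler_sum => i _.
  by rewrite (top_system_val _ _ _ _ vP).
by rewrite big_ord_recr/= (sigma_dim sv dn) expr0n addr0.
Qed.

(** A finite orthonormal family nearly exhausts [V], and by Ky Fan the same number of top
    eigenvalues does at least as well. The family itself witnesses that the dimension is large
    enough. *)
Lemma singular_sum_cvg : \sum_(i < n) sigma i ^+ 2 @[n --> \oo] --> V.
Proof.
apply/cvgrPdist_le => e e0.
have [N [u [uN Ne]]] := covariance_trace_approx sdot dot_norm H_separable mu mu_bounded e e0.
exists N => // n /= Nn; rewrite ger0_norm ?subr_ge0 ?singular_sum_le//.
have dN : dim_ge H N.
  by exists (fun i : 'I_N => u i); exact: (orthonormal_free sdot N u uN).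
have := ky_fan_le sdot dot_norm psdB N v _ u (singular_top N dN) uN.
have : \sum_(i < N) sigma i ^+ 2 <= \sum_(i < n) sigma i ^+ 2.
  rewrite -!(big_mkord xpredT (fun i => sigma i ^+ 2)) (big_cat_nat (leq0n N) Nn)//= lerDl.
  by apply: sumr_ge0 => i _; exact: sqr_ge0.
move: Ne; rewrite -/V -/B; lra.
Qed.

Lemma singular_tail d :
  (\sum_(d <= i <oo) (sigma i ^+ 2)%:E)%E = (V - \sum_(i < d) sigma i ^+ 2)%:E.
Proof.
apply: cvg_lim => //; apply: cvg_EFin.
  by apply: nearW => n; rewrite sumEFin.
have c : \sum_(i < n) sigma i ^+ 2 - \sum_(i < d) sigma i ^+ 2 @[n --> \oo] -->
    V - \sum_(i < d) sigma i ^+ 2.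
  by apply: cvgB; [exact: singular_sum_cvg|exact: cvg_cst].
apply: cvg_trans c; apply: near_eq_cvg; exists d => // n /= dn.
rewrite sumEFin/= -!(big_mkord xpredT (fun i => sigma i ^+ 2)).
by rewrite (big_cat_nat (leq0n d) dn)//= addrAC subrr add0r.
Qed.

(** The error of a flat exceeds the optimum through the Ky Fan deficit and through the squared
    distance [dot q q] of the center of mass; both are nonnegative, so optimality annihilates
    both. *)
Lemma LS_flat_unique k : dim_ge H k.+1 -> sigma k.+1 < sigma k ->
  forall L, is_LS_flat mu k.+1 L -> L = translate m (span k.+1 v).
Proof.
move=> dk sk L [/(AG_orthonormal sdot dot_norm)[p [u [uk ->]]] Le].
have vP := singular_top k.+1 dk; have [vk _ _] := vP.
have [e2E _] := top_system_LS _ _ _ vP.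
have [_ dot0] := dot_psd sdot dot_norm.
have s2 : sigma k.+1 ^+ 2 < sigma k ^+ 2.
  by rewrite ltr_pXn2r// ?nnegrE (sigma_ge0 sv).
have kf := ky_fan sdot dot_norm psdB k v _ (sigma k.+1 ^+ 2) u vP (ltW s2)
  (fun w => singular_max k.+1 w dk) uk.
move: Le; rewrite e2E (ls_error_flat sdot dot_norm H_separable mu mu_bounded)//.
rewrite -/m -/B -/V; set q := m - p - _ => Le.
set S := \sum_(j < k.+1) dot _ _ in kf.
have S0 : 0 <= S by apply: sumr_ge0 => j _; exact: dot0.
have uB := trB k.+1 u uk; rewrite -/B -/V in uB.
have VE : V - \sum_(i < k.+1) B (u i) (u i) + dot q q = V - \sum_(i < k.+1) sigma i ^+ 2.
  have h1 : 0 <= V - \sum_(i < k.+1) B (u i) (u i) + dot q q.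
    by rewrite addr_ge0// subr_ge0.
  have h2 : 0 <= V - \sum_(i < k.+1) sigma i ^+ 2 by rewrite subr_ge0 singular_sum_le.
  (* Nonnegativity of both radicands, [h1] and [h2], lets squaring recover them. *)
  have /(congr1 (fun x => x ^+ 2)%E) := Le.
  by rewrite !sqr_sqrte ?lee_fin// => -[].
have q0 := dot0 q.
have sS : (sigma k ^+ 2 - sigma k.+1 ^+ 2) * S = 0.
  have : 0 <= (sigma k ^+ 2 - sigma k.+1 ^+ 2) * S by rewrite mulr_ge0// subr_ge0 ltW.
  lra.
have qE : q = 0 by apply: (dot_eq0 dot_norm); lra.
have SE : S = 0.
  move/eqP: sS; rewrite mulf_eq0 => /orP[|/eqP//].
  by rewrite subr_eq0 => /eqP e; move: s2; rewrite e ltxx.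
have uv i : (i < k.+1)%N -> span k.+1 v (u i).
  move=> ik; move/eqP: SE; rewrite psumr_eq0; last by move=> j _; exact: dot0.
  move=> /allP/(_ (Ordinal ik)); rewrite mem_index_enum => /(_ isT)/eqP /=.
  by move=> /(dot_eq0 dot_norm)/eqP; rewrite subr_eq0 => /eqP ->; exact: span_proj.
rewrite -(span_orthonormal_eq sdot dot_norm k.+1 u v uk vk uv).
(* Since [q = 0], the base points [p] and [m] differ by a vector of the direction. *)
have mp : span k.+1 u (m - p).
  by move/eqP: qE; rewrite subr_eq0 => /eqP ->; exact: span_proj.
apply/seteqP; split=> _ [w uw <-].
  exists (w - (m - p)); first exact: spanB.
  by rewrite opprB addrCA (addrC m) subrK addrC.
exists (m - p + w); first exact: spanD.
by rewrite addrA [p + _]addrC subrK.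
Qed.

(** Replacing [v k] by [v k.+1], which has the same eigenvalue, keeps the captured trace but changes
    the span. *)
Lemma LS_flat_not_unique k : dim_ge H k.+2 -> sigma k.+1 = sigma k ->
  exists2 L, is_LS_flat mu k.+1 L & L <> translate m (span k.+1 v).
Proof.
move=> dk sk; have vk2 := singular_orthonormal k.+2 dk.
have vP := singular_top k.+1 (dim_geW _ _ (leqnSn _) dk); have [vk _ _] := vP.
have [e2E _] := top_system_LS _ _ _ vP.
pose u := extend k v (v k.+1).
have uk : orthonormal_fam dot k.+1 u.
  apply: (orthonormal_extend sdot); first exact: orthonormalW vk.
    by move=> i ik; rewrite vk2 ?ltn_eqF// ltnS ltnW// ltnW.
  by rewrite vk2 ?eqxx.
exists (translate m (span k.+1 u)).
  split; first by apply/(AG_orthonormal sdot dot_norm); exists m, u.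
  rewrite e2E (ls_error_flat sdot dot_norm H_separable mu mu_bounded)// -/m -/B -/V.
  rewrite subrr (proj_id sdot)//; last exact: span0.
  rewrite subr0 (symf0l sdot) addr0; congr (sqrte (V - _)%:E).
  rewrite !big_ord_recr/=; congr (_ + _).
    apply: eq_bigr => i _; rewrite /u extend_lt//; apply: top_system_val _ _ _ _ vP _.
    by rewrite ltnS ltnW.
  by rewrite /u extend_eq singular_eigen// vk2// eqxx mulr1 sk.
(* The flats are separated by [m + v k], as [v k] is orthogonal to every vector of [u]. *)
move=> uv; have : translate m (span k.+1 v) (m + v k).
  by exists (v k) => //; exact: span_gen.
rewrite -uv => -[w uw /addrI wk]; rewrite wk in uw.
have := perp_span sdot k.+1 u (v k) (v k) _ uw.
rewrite vk// eqxx => h; have /eqP : (1 : R) = 0.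
  apply: h => i; rewrite ltnS leq_eqVlt => /predU1P[->|ik].
    by rewrite /u extend_eq vk2// gtn_eqF.
  by rewrite /u extend_lt// vk ?ltn_eqF// ltnS ltnW.
by rewrite oner_eq0.
Qed.

End Singular.
End SingularSystem.

Theorem proposition3p1 (R : realType) (H : completeNormedModType R)
    (dot : {dot H for idfun}) (dot_norm : forall x : H, dot x x = `|x| ^+ 2)
    (H_separable : separable H)
    (d : nat) (d_ge1 : (1 <= d)%N) (dim_H : dim_ge H d.+1)
    (mu : probability (borel H) R) (mu_bounded : bounded_set (supp mu)) :
  (exists L : set H, is_LS_flat mu d L) /\
  forall (sigma : nat -> R) (v : nat -> H), singular_system dot mu sigma v ->
    [/\ is_LS_flat mu d
          (translate (center_of_mass mu) (Sp [set v i | i in [set i | (i < d)%N]])),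
        (exists! L : set H, is_LS_flat mu d L) <-> sigma d.-1 > sigma d
      & e2 mu d = sqrte (\sum_(d <= i <oo) (sigma i ^+ 2)%:E)%E].
Proof.
have sdot := dot_symform dot.
have psdB := covariance_psd sdot dot_norm H_separable mu mu_bounded.
have trB := covariance_trace sdot dot_norm H_separable mu mu_bounded.
have dd : dim_ge H d := dim_geW _ _ (leqnSn d) dim_H.
split.
  have [v [l vP]] := top_system_exists sdot dot_norm psdB trB d dd.
  exists (translate (center_of_mass mu) (span d v)).
  by have [] := top_system_LS dot dot_norm H_separable mu mu_bounded d v l vP.
move=> sigma v sv.
have vP := singular_top dot dot_norm H_separable mu mu_bounded sv d dd.
have [e2E LS] := top_system_LS dot dot_norm H_separable mu mu_bounded _ _ _ vP.
rewrite Sp_span; split=> //; last first.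
  by rewrite (singular_tail dot dot_norm H_separable mu mu_bounded sv).
(* With [d = k.+1] and indices from 0, the gap lies between [sigma k] and [sigma k.+1]. *)
case: d d_ge1 dim_H dd vP e2E LS => [//|k] _ dim_H dd vP e2E LS /=.
split=> [[L [LL Lu]]|sk].
  rewrite lt_neqAle (sigma_nonincreasing sv (leqnSn k)) andbT; apply/negP => /eqP sk.
  have [L' LL' /=] := LS_flat_not_unique dot dot_norm H_separable mu mu_bounded sv k dim_H sk.
  by apply; rewrite -(Lu _ LL') (Lu _ LS).
exists (translate (center_of_mass mu) (span k.+1 v)); split=> // L LL.
by rewrite (LS_flat_unique dot dot_norm H_separable mu mu_bounded sv k dd sk L LL).
Qed.
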